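(* Let $M$ be an even-dimensional complete non-cocompact $G$-Riemannian manifold, and let $E_0\to M$ be a $\mathbb{Z}_2$-graded $G$-Clifford bundle with grading operator $z$. Let $U_0\in\mathrm{Mat}_l(C(\partial_h^G(\overline{M})))$ be a unitary for some $l\ge0$, and let $U\in\mathrm{Mat}_l(C_g^{\infty,G}(M))$ be a lift of $U_0$. Form the $\mathbb{Z}_2$-graded bundle $E=E_0\otimes(\mathbb{C}^l\oplus(\mathbb{C}^{l})^{op})$ with the Dirac operator $D$ formed from the connection on $E_0$ twisted by the trivial connection on $M\times\mathbb{C}^l$, and define $$\Phi=z\otimes\begin{bmatrix} 0 & U^* \\ U & 0 \end{bmatrix}\in C^1(M,\mathrm{End}(E)).$$ Then $\Phi$ is a $G$-admissible endomorphism for $D$.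
   Context: $G$ is a Lie group. A $G$-Riemannian manifold is a Riemannian manifold on which $G$ acts smoothly, properly and isometrically. A subset of $M$ is cocompact if its image in $M/G$ has compact closure; $M$ is non-cocompact if $M/G$ is non-compact. A $G$-Clifford bundle is a $G$-equivariant Hermitian Clifford module bundle with invariant Clifford connection (Clifford multiplication is odd when the bundle is $\mathbb{Z}_2$-graded). $C_b^G(M)$: bounded continuous $G$-invariant functions on $M$. $C_0^G(M)$: $G$-invariant continuous functions $f$ such that for every $\epsilon>0$ there is a cocompact $M_1\subseteq M$ with $|f|<\epsilon$ on $M\setminus M_1$. $C_g^{\infty,G}(M)\subset C_b^G(M)$: bounded smooth $G$-invariant functions $f$ with $\|df\|_{T^*M}\in C_0^G(M)$. $C_g^G(M)$ is the completion of $C_g^{\infty,G}(M)$ in $C_b^G(M)$ for the sup norm, and $C(\partial_h^G(\overline{M}))=C_g^G(M)/C_0^G(M)$; its maximal ideal space is the Higson $G$-corona. The matrix in $\Phi$ is written with respect to $\mathbb{C}^l\oplus(\mathbb{C}^l)^{op}$, and $E$ carries the tensor product grading. An odd, $G$-invariant endomorphism $\Phi\in C^1(M,\mathrm{End}\,E)$ of a $\mathbb{Z}_2$-graded $G$-Clifford bundle $E$ with Dirac operator $D$ is $G$-admissible for $D$ if (a) $\Phi D+D\Phi$ is a bounded, order-$0$ bundle endomorphism; (b) $\Phi$ is self-adjoint for the inner product on $E$; (c) there are a cocompact subset $K\subseteq M$ and $C>0$ with $\Phi D+D\Phi+\Phi^2\ge C$ on $M\setminus K$. *)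

(* Defs.v *)
From HB Require Import structures.
From mathcomp Require Import all_boot all_order all_algebra.
From mathcomp Require Import generic_quotient ring_quotient.
From mathcomp Require Import complex.
From mathcomp Require Import all_classical all_reals all_analysis.

Set Implicit Arguments.
Unset Strict Implicit.
Unset Printing Implicit Defensive.

Import Order.TTheory GRing.Theory Num.Theory.
Import numFieldNormedType.Exports.

Local Open Scope classical_set_scope.
Local Open Scope complex_scope.
Local Open Scope ring_scope.

(* f is of class C^k on A, for A open *)
Fixpoint Ck (R : realType) (V W : normedModType R) (k : nat) (A : set V)
    (f : V -> W) : Prop :=
  match k with
  | 0 => forall x, A x -> {for x, continuous f}
  | k'.+1 => (forall x, A x -> differentiable f x) /\
             (forall v, Ck k' A ('D_v f : V -> W))
  end.

(* Charts: chart_fun and chart_inv are total functions, meaningful only on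
   chart_dom and chart_img respectively. *)
Record chart (R : realType) (n : nat) (T : topologicalType) := Chart {
  chart_dom : set T;
  chart_img : set 'rV[R]_n;
  chart_fun :> T -> 'rV[R]_n;
  chart_inv : 'rV[R]_n -> T }.

Definition is_chart (R : realType) (n : nat) (T : topologicalType)
    (c : chart R n T) : Prop :=
  [/\ open (chart_dom c) /\ open (chart_img c),
      forall x, chart_dom c x -> chart_img c (c x) /\ chart_inv c (c x) = x,
      forall u, chart_img c u ->
        chart_dom c (chart_inv c u) /\ c (chart_inv c u) = u,
      forall x, chart_dom c x -> {for x, continuous c} &
      forall u, chart_img c u -> {for u, continuous (chart_inv c)}].

Section SmoothMaps.
Context {R : realType}.

Definition Ck_on (n : nat) (T : topologicalType) (W : normedModType R)
    (A : set (chart R n T)) (k : nat) (D : set T) (f : T -> W) : Prop :=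
  forall c, A c -> Ck k (chart_img c `&` chart_inv c @^-1` D)
                        (f \o chart_inv c).

Definition CkC_on (n : nat) (T : topologicalType) (A : set (chart R n T))
    (k : nat) (D : set T) (f : T -> R[i]) : Prop :=
  Ck_on A k D (fun x => complex.Re (f x)) /\
  Ck_on A k D (fun x => complex.Im (f x)).

Definition smooth_map (n m : nat) (S T : topologicalType)
    (A : set (chart R n S)) (B : set (chart R m T)) (f : S -> T) : Prop :=
  continuous f /\
  forall b, B b -> forall k, Ck_on A k (f @^-1` chart_dom b) (b \o f).

Definition prod_chart (n m : nat) (S T : topologicalType)
    (a : chart R n S) (b : chart R m T) : chart R (n + m) (S * T)%type :=
  Chart (chart_dom a `*` chart_dom b)
    [set u | chart_img a (lsubmx u) /\ chart_img b (rsubmx u)]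
    (fun p => row_mx (a p.1) (b p.2))
    (fun u => (chart_inv a (lsubmx u), chart_inv b (rsubmx u))).

Definition prod_atlas (n m : nat) (S T : topologicalType)
    (A : set (chart R n S)) (B : set (chart R m T)) :=
  [set prod_chart a b | a in A & b in B].

End SmoothMaps.

HB.mixin Record isManifold (R : realType) (n : nat) M of Topological M := {
  atlas : set (chart R n M);
  atlas_chart : forall c, atlas c -> is_chart c;
  atlas_cover : forall x : M, exists c, atlas c /\ chart_dom c x;
  atlas_compat : forall a b, atlas a -> atlas b -> forall k,
    Ck k (chart_img a `&` chart_inv a @^-1` chart_dom b) (b \o chart_inv a);
  manifold_hausdorff : hausdorff_space M;
  manifold_countable : @second_countable M }.

#[short(type="manifoldType")]
HB.structure Definition Manifold (R : realType) (n : nat) :=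
  {M of Topological M & isManifold R n M}.

HB.mixin Record isLieGroup (R : realType) (k : nat) G
    of Manifold R k G & Group G := {
  lie_mul_smooth : smooth_map (prod_atlas (@atlas R k G) (@atlas R k G))
    (@atlas R k G) (fun p : G * G => (p.1 * p.2)%g);
  lie_inv_smooth : smooth_map (@atlas R k G) (@atlas R k G)
    (fun g : G => (g^-1)%g) }.

#[short(type="lieGroupType")]
HB.structure Definition LieGroup (R : realType) (k : nat) :=
  {G of Manifold R k G & Group G & isLieGroup R k G}.

(* One fixed chart around each point. A tangent vector at x is represented by
   its coordinates in this preferred chart. *)
Definition chart_at (R : realType) (n : nat) (M : manifoldType R n) (x : M) :
  chart R n M := sval (cid (@atlas_cover R n M x)).

Definition tangent (R : realType) (n : nat) (M : manifoldType R n) (x : M) :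
  normedModType R := 'rV[R]_n.

Section Tangent.
Context {R : realType} {n : nat} {M : manifoldType R n}.

Definition basis_vec (x : M) (i : 'I_n) : tangent x := delta_mx 0 i.

Definition dreal (W : normedModType R) (f : M -> W) (x : M) (v : tangent x) : W :=
  'D_v (f \o chart_inv (chart_at x)) (chart_at x x).

Definition dcomplex (f : M -> R[i]) (x : M) (v : tangent x) : R[i] :=
  dreal (fun y => complex.Re (f y)) v +i* dreal (fun y => complex.Im (f y)) v.

Definition dmap (m : nat) (N : manifoldType R m) (f : M -> N) (x : M)
    (v : tangent x) : tangent (f x) :=
  dreal (chart_at (f x) \o f) v.

(* The coordinate vector field d/dx_i of the chart c, at the point x *)
Definition coord_vec (c : chart R n M) (i : 'I_n) (x : M) : tangent x :=
  'D_(delta_mx 0 i) (chart_at x \o chart_inv c) (c x).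

Definition CkM (k : nat) (f : M -> R[i]) : Prop :=
  CkC_on (@atlas R n M) k setT f.

Definition vfield := forall x : M, tangent x.

Definition Ck_vfield (k : nat) (X : vfield) : Prop :=
  forall c, @atlas R n M c ->
    Ck_on (@atlas R n M) k (chart_dom c) (fun x => dreal c (X x)).

Record riemannian := Riemannian {
  metric : forall x : M, tangent x -> tangent x -> R;
  metric_sym : forall x (v w : tangent x), metric v w = metric w v;
  metric_linear : forall x (a : R) (u v w : tangent x),
    metric (a *: u + v) w = a * metric u w + metric v w;
  metric_pos : forall x (v : tangent x), v != 0 -> 0 < metric v v;
  metric_smooth : forall c, @atlas R n M c -> forall i j k,
    Ck_on (@atlas R n M) k (chart_dom c)
      (fun x => metric (coord_vec c i x) (coord_vec c j x) : R) }.

Definition tnorm (g : riemannian) (x : M) (v : tangent x) : R :=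
  Num.sqrt (metric g v v).

(* The matrix of the metric induced on the cotangent space at x, in the basis
   dual to basis_vec x *)
Definition cometric (g : riemannian) (x : M) : 'M[R]_n :=
  invmx (\matrix_(i, j) metric g (basis_vec x i) (basis_vec x j)).

(* The norm of df for a complex-valued f, for the Hermitian extension of the
   cometric: it is the square root of |d Re f|^2 + |d Im f|^2. *)
Definition dnorm (g : riemannian) (f : M -> R[i]) (x : M) : R :=
  Num.sqrt (\sum_i \sum_j cometric g x i j *
    (dreal (fun y => complex.Re (f y)) (basis_vec x i) *
     dreal (fun y => complex.Re (f y)) (basis_vec x j) +
     dreal (fun y => complex.Im (f y)) (basis_vec x i) *
     dreal (fun y => complex.Im (f y)) (basis_vec x j))).

(* C^1 paths on [0, 1]: being C^1 up to the end points means having a C^1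
   extension to an open interval containing [0, 1]. As the velocity may vanish,
   piecewise C^1 paths yield the same distance. *)
Definition C1_path (p q : M) (gam : R -> M) : Prop :=
  [/\ gam 0 = p, gam 1 = q &
      exists e : R, 0 < e /\
        (forall t, `]- e, 1 + e[%classic t -> {for t, continuous gam}) /\
        (forall c, @atlas R n M c ->
           Ck 1 (`]- e, 1 + e[%classic `&` gam @^-1` chart_dom c)
             (c \o gam : R -> 'rV[R]_n))].

Definition velocity (gam : R -> M) (t : R) : tangent (gam t) :=
  'D_1 (chart_at (gam t) \o gam) t.

Definition path_length (g : riemannian) (gam : R -> M) : \bar R :=
  (\int[lebesgue_measure]_(t in `[0%R, 1%R]) (tnorm g (velocity gam t))%:E)%E.

Definition riem_dist (g : riemannian) (p q : M) : \bar R :=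
  ereal_inf [set path_length g gam | gam in C1_path p q].

Definition riem_complete (g : riemannian) : Prop :=
  forall u : nat -> M,
    (forall e : R, 0 < e -> exists N : nat, forall i j,
       (N <= i)%N -> (N <= j)%N -> (riem_dist g (u i) (u j) < e%:E)%E) ->
    exists p : M, u @ \oo --> p.

(* nab x v Y is the covariant derivative of Y in
   the direction v in T_x M. The torsion-free condition is stated with the
   bracket [X, Y] = X Y - Y X acting on functions. *)
Definition is_levi_civita (g : riemannian)
    (nab : forall x : M, tangent x -> vfield -> tangent x) : Prop :=
  let smooth (Y : vfield) := forall k, Ck_vfield k Y in
  let smooth_fun (f : M -> R) := forall k, Ck_on (@atlas R n M) k setT f in
  [/\ forall x (a : R) (v w : tangent x) Y, smooth Y ->
        nab x (a *: v + w) Y = a *: nab x v Y + nab x w Y,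
      forall x (v : tangent x) Y Z, smooth Y -> smooth Z ->
        nab x v (fun y => Y y + Z y) = nab x v Y + nab x v Z,
      forall x (v : tangent x) f Y, smooth_fun f -> smooth Y ->
        nab x v (fun y => f y *: Y y) = dreal f v *: Y x + f x *: nab x v Y,
      forall X Y, smooth X -> smooth Y -> smooth (fun x => nab x (X x) Y) &
      (forall x (v : tangent x) Y Z, smooth Y -> smooth Z ->
         dreal (fun y => metric g (Y y) (Z y)) v =
         metric g (nab x v Y) (Z x) + metric g (Y x) (nab x v Z)) /\
      (forall X Y f, smooth X -> smooth Y -> smooth_fun f -> forall x,
         dreal f (nab x (X x) Y - nab x (Y x) X) =
         dreal (fun y => dreal f (Y y)) (X x) -
         dreal (fun y => dreal f (X y)) (Y x))].

End Tangent.

Arguments riemannian {R n} M.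
Arguments vfield {R n} M.

Record gRiemannian (R : realType) (k n : nat) (G : lieGroupType R k) :=
  GRiemannian {
  gcarrier :> manifoldType R n;
  gmetric : riemannian gcarrier;
  act : G -> gcarrier -> gcarrier;
  act1 : forall x, act 1%g x = x;
  actM : forall g h x, act (g * h)%g x = act g (act h x);
  act_smooth : smooth_map
    (prod_atlas (@atlas R k G) (@atlas R n gcarrier)) (@atlas R n gcarrier)
    (fun p : G * gcarrier => act p.1 p.2);
  act_proper : forall K : set (gcarrier * gcarrier), compact K ->
    compact [set p : G * gcarrier | K (act p.1 p.2, p.2)];
  act_isometric : forall g x (v w : tangent x),
    metric gmetric (dmap (act g) v) (dmap (act g) w) = metric gmetric v w }.

Section OrbitSpace.
Context {R : realType} {k n : nat} {G : lieGroupType R k}.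
Variable M : gRiemannian n G.
Local Open Scope quotient_scope.

Definition orbit_rel (x y : M) : bool := `[< exists g, act g x = y >].

Lemma orbit_rel_equiv : equiv_class_of orbit_rel.
Proof.
split => [x|x y|y x z].
- by apply/asboolP; exists 1%g; rewrite act1.
- by apply/asboolP/asboolP => -[g <-]; exists (g^-1)%g;
    rewrite -actM mulVg act1.
- move=> /asboolP[g <-] /asboolP[h <-].
  by apply/asboolP; exists (h * g)%g; rewrite actM.
Qed.

Canonical orbit_rel_equivRel := EquivRelPack orbit_rel_equiv.
Canonical orbit_rel_encModRel := defaultEncModRel orbit_rel.

Definition orbit_space : topologicalType :=
  quotient_topology {eq_quot orbit_rel}.

Definition orbit_proj (x : M) : orbit_space := \pi_({eq_quot orbit_rel}) x.

Definition cocompact (A : set M) : Prop := compact (closure (orbit_proj @` A)).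

Definition non_cocompact : Prop := ~ compact [set: orbit_space].

End OrbitSpace.

Section HigsonCorona.
Context {R : realType} {k n : nat} {G : lieGroupType R k}.
Variable M : gRiemannian n G.

Definition g_invariant (f : M -> R[i]) : Prop :=
  forall g x, f (act g x) = f x.

Definition is_CbG (f : M -> R[i]) : Prop :=
  [/\ continuous (f : M -> R[i]^o), g_invariant f &
      exists B : R, forall x, `|f x| <= B%:C].

Definition is_C0G (f : M -> R[i]) : Prop :=
  [/\ continuous (f : M -> R[i]^o), g_invariant f &
      forall e : R, 0 < e -> exists M1 : set M,
        cocompact M1 /\ forall x, ~ M1 x -> `|f x| < e%:C].

Definition is_CginfG (f : M -> R[i]) : Prop :=
  [/\ is_CbG f, forall r, CkM r f &
      is_C0G (fun x => (dnorm (gmetric M) f x)%:C)].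

Definition is_CgG (f : M -> R[i]) : Prop :=
  is_CbG f /\ forall e : R, 0 < e -> exists h : M -> R[i],
    is_CginfG h /\ forall x, `|f x - h x| <= e%:C.

End HigsonCorona.

Section CoronaAlgebra.
Context {R : realType} {k n : nat} {G : lieGroupType R k}.
Variable M : gRiemannian n G.
Local Open Scope quotient_scope.

Definition CbG_pred : {pred (M -> R[i])} := [pred f | `[< is_CbG f >]].

Lemma normC_lerP (f : M -> R[i]) :
  (exists B : R, forall x, `|f x| <= B%:C) ->
  exists B : R, 0 <= B /\ forall x, `|f x| <= B%:C.
Proof.
move=> [B HB]; exists `|B|; split => // x.
by apply: (le_trans (HB x)); rewrite lecR ler_norm.
Qed.

Lemma CbG_subring_closed : subring_closed CbG_pred.
Proof.
split.
- apply/asboolP; split; [exact: cst_continuous | by [] |].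
  by exists 1 => x; rewrite normr1.
- move=> f g /asboolP[fc fi [B fB]] /asboolP[gc gi [B' gB]].
  apply/asboolP; split.
  + move=> x; apply: (@continuousB R[i] R[i]^o M f g x); [exact: fc|exact: gc].
  + by move=> a x; rewrite !fctE fi gi.
  + exists (B + B') => x; rewrite (le_trans (ler_normB _ _))//.
    by rewrite rmorphD lerD.
- move=> f g /asboolP[fc fi [B fB]] /asboolP[gc gi [B' gB]].
  apply/asboolP; split.
  + move=> x; apply: (@continuousM R[i] M f g x); [exact: fc|exact: gc].
  + by move=> a x; rewrite !fctE fi gi.
  + by exists (B * B') => x; rewrite normrM rmorphM ler_pM.
Qed.

HB.instance Definition _ :=
  GRing.isSubringClosed.Build (M -> R[i]) CbG_pred CbG_subring_closed.

Record CbG := MkCbG { CbG_fun :> M -> R[i]; CbG_funP : CbG_fun \in CbG_pred }.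

HB.instance Definition _ := [isSub for CbG_fun].
HB.instance Definition _ := [Choice of CbG by <:].
HB.instance Definition _ := GRing.SubChoice_isSubComPzRing.Build (M -> R[i]) CbG_pred CbG CbG_subring_closed.

Definition C0G : {pred CbG} := [pred f : CbG | `[< is_C0G f >]].

Lemma cocompactU (A B : set M) :
  cocompact A -> cocompact B -> cocompact (A `|` B).
Proof.
by rewrite /cocompact image_setU closureU => cA cB; exact: compactU.
Qed.

Lemma cocompact0 : @cocompact _ _ _ _ M set0.
Proof. by rewrite /cocompact image_set0 closure0; exact: compact0. Qed.

Lemma C0G_zmod_closed : zmod_closed C0G.
Proof.
split.
- apply/asboolP; split; [exact: cst_continuous | by [] |].
  move=> e e0; exists set0; split; first exact: cocompact0.
  by move=> x _; rewrite normr0 ltcR.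
- move=> f g /asboolP[fc fi f0] /asboolP[gc gi g0].
  have /asboolP[hc hi _] := CbG_funP (f - g).
  apply/asboolP; split => // e e0.
  have e2 : 0 < e / 2 by rewrite divr_gt0.
  have [A [cA fA]] := f0 _ e2; have [B [cB gB]] := g0 _ e2.
  exists (A `|` B); split; first exact: cocompactU.
  move=> x /not_orP[/fA fx /gB gx].
  rewrite (le_lt_trans (ler_normB _ _))// [e]splitr rmorphD.
  by rewrite ltrD.
Qed.

HB.instance Definition _ := GRing.isZmodClosed.Build CbG C0G C0G_zmod_closed.

Lemma C0GMl (f g : CbG) : g \in C0G -> f * g \in C0G.
Proof.
move=> /asboolP[gc gi g0].
have /asboolP[_ _ /normC_lerP[B [B0 fB]]] := CbG_funP f.
have /asboolP[hc hi _] := CbG_funP (f * g).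
apply/asboolP; split => // e e0.
have B1 : 0 < B + 1 by rewrite ltr_wpDl.
have [A [cA gA]] := g0 (e / (B + 1)) (divr_gt0 e0 B1).
exists A; split => // x /gA gx.
rewrite normrM (@le_lt_trans _ _ ((B + 1)%:C * `|g x|))//.
  apply: ler_wpM2r => //; apply: (le_trans (fB x)).
  by rewrite lecR lerDl.
rewrite (_ : e%:C = (B + 1)%:C * (e / (B + 1))%:C).
  by rewrite ltr_pM2l// ltcR.
by rewrite -rmorphM mulrCA divff ?mulr1// gt_eqF.
Qed.

(* The ring structure is defined here because the one in ring_quotient is only
   for proper ideals of non-trivial rings. *)
Definition CbG_mod_C0G := {ideal_quot C0G}.

HB.instance Definition _ := GRing.Zmodule.on CbG_mod_C0G.

Definition corona_pi : CbG -> CbG_mod_C0G := fun f => \pi_{ideal_quot C0G} f.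

Let one : CbG_mod_C0G := corona_pi 1.
Let mul (a b : CbG_mod_C0G) : CbG_mod_C0G :=
  corona_pi (repr (a : {ideal_quot C0G}) * repr (b : {ideal_quot C0G})).

Lemma corona_piE f g : (corona_pi f == corona_pi g) = (f - g \in C0G).
Proof. by rewrite /corona_pi Quotient.idealrBE. Qed.

Lemma corona_repr f : repr (corona_pi f : {ideal_quot C0G}) - f \in C0G.
Proof. by rewrite Quotient.idealrBE reprK. Qed.

Let mul_pi f g : mul (corona_pi f) (corona_pi g) = corona_pi (f * g).
Proof.
apply/eqP; rewrite /mul corona_piE.
set f' := repr _; set g' := repr _.
rewrite (_ : f' * g' - f * g = f' * (g' - g) + g * (f' - f)); last first.
  by rewrite !mulrBr addrA (mulrC g f') subrK (mulrC g f).
by rewrite rpredD// C0GMl// corona_repr.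
Qed.

Lemma corona_piP (a : CbG_mod_C0G) : exists f, a = corona_pi f.
Proof. by exists (repr (a : {ideal_quot C0G})); rewrite /corona_pi reprK. Qed.

Lemma corona_piD f g : corona_pi (f + g) = corona_pi f + corona_pi g.
Proof. by rewrite /corona_pi !piE. Qed.

Let mulA : associative mul.
Proof.
move=> a b c; have [f ->] := corona_piP a; have [g ->] := corona_piP b.
by have [h ->] := corona_piP c; rewrite !mul_pi mulrA.
Qed.

Let mulC : commutative mul.
Proof.
move=> a b; have [f ->] := corona_piP a; have [g ->] := corona_piP b.
by rewrite !mul_pi mulrC.
Qed.

Let mul1 : left_id one mul.
Proof. by move=> a; have [f ->] := corona_piP a; rewrite mul_pi mul1r. Qed.

Let mulDl : left_distributive mul +%R.
Proof.
move=> a b c; have [f ->] := corona_piP a; have [g ->] := corona_piP b.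
by have [h ->] := corona_piP c; rewrite -corona_piD !mul_pi -corona_piD mulrDl.
Qed.

HB.instance Definition _ :=
  GRing.Zmodule_isComPzRing.Build CbG_mod_C0G mulA mulC mul1 mulDl.

Lemma corona_piM f g : corona_pi (f * g) = corona_pi f * corona_pi g.
Proof. by rewrite -mul_pi. Qed.

Lemma corona_pi1 : corona_pi 1 = 1.
Proof. by []. Qed.

Lemma CbG_conj_subproof (f : CbG) : (fun x => (f x)^*) \in CbG_pred.
Proof.
have /asboolP[fc fi [B fB]] := CbG_funP f; apply/asboolP; split.
- move=> x; apply/(@cvgrPdist_lt R[i] R[i]^o) => e e0.
  have /(@cvgrPdist_lt R[i] R[i]^o)/(_ e e0) := fc x.
  by apply: filterS => t; rewrite -rmorphB norm_conjC.
- by move=> g x; rewrite fi.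
- by exists B => x; rewrite norm_conjC.
Qed.

Definition CbG_conj (f : CbG) : CbG := MkCbG (CbG_conj_subproof f).

Definition corona_conj (a : CbG_mod_C0G) : CbG_mod_C0G :=
  corona_pi (CbG_conj (repr (a : {ideal_quot C0G}))).

Lemma corona_pi_conj f : corona_pi (CbG_conj f) = corona_conj (corona_pi f).
Proof.
apply/eqP; rewrite /corona_conj corona_piE.
have /asboolP[hc hi _] := CbG_funP (CbG_conj f - CbG_conj (repr (corona_pi f : {ideal_quot C0G}))).
have /asboolP[_ _ h0] := corona_repr f.
apply/asboolP; split => // e /h0[A [cA HA]]; exists A; split => // x /HA.
by rewrite /= !fctE -rmorphB norm_conjC distrC.
Qed.

(* The algebra of functions on the corona, C_g^G(M) / C_0^G(M), as a subalgebra
   of C_b^G(M) / C_0^G(M) *)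
Definition higson_corona : set CbG_mod_C0G :=
  [set corona_pi f | f in [set f : CbG | is_CgG f]].

Definition unitary_mx (l : nat) (U : 'M[CbG_mod_C0G]_l) : Prop :=
  U *m (map_mx corona_conj U)^T = 1%:M /\
  (map_mx corona_conj U)^T *m U = 1%:M.

End CoronaAlgebra.

Section CliffordBundles.
Context {R : realType} {k n : nat} {G : lieGroupType R k}.
Variable M : gRiemannian n G.

Local Notation C := R[i].
Local Notation atlasM := (@atlas R n M).

(* A local frame of a family of complex vector spaces, with the coordinates
   in it; both are meaningful only over fr_dom. *)
Record local_frame (E : M -> lmodType C) := LocalFrame {
  fr_dom : set M;
  fr_rank : nat;
  fr_sec : 'I_fr_rank -> forall x, E x;
  fr_coo : 'I_fr_rank -> forall x, E x -> C }.

Definition is_frame (E : M -> lmodType C) (F : local_frame E) : Prop :=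
  open (fr_dom F) /\
  forall x, fr_dom F x ->
    (forall v : E x, v = \sum_i fr_coo (l := F) i v *: fr_sec (l := F) i x) /\
    (forall (a : 'I_(fr_rank F) -> C) j,
       fr_coo (l := F) j (\sum_i a i *: fr_sec (l := F) i x) = a j).

(* nab x v s is the covariant derivative of the section s in the direction v in
   T_x M; it is meaningful for sections of class C^1. *)
Record cliffordData := CliffordData {
  fiber :> M -> lmodType C;
  frames : set (local_frame fiber);
  herm : forall x, fiber x -> fiber x -> C;
  grading : forall x, fiber x -> fiber x;
  cliff : forall x, tangent x -> fiber x -> fiber x;
  nab : forall x, tangent x -> (forall y, fiber y) -> fiber x;
  gact : forall (g : G) x, fiber x -> fiber (act g x) }.

Arguments frames : clear implicits.

Definition section_of (E : cliffordData) := forall x : M, E x.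

Definition Ck_section (E : cliffordData) (r : nat) (s : section_of E) : Prop :=
  forall F, frames E F -> forall i,
    CkC_on atlasM r (fr_dom F) (fun x => fr_coo (l := F) i (s x)).

Definition Ck_endo (E : cliffordData) (r : nat)
    (T : forall x : M, E x -> E x) : Prop :=
  forall F, frames E F -> forall i j,
    CkC_on atlasM r (fr_dom F)
      (fun x => fr_coo (l := F) i (T x (fr_sec (l := F) j x))).

Definition is_vector_bundle (E : cliffordData) : Prop :=
  [/\ forall F, frames E F -> is_frame F,
      forall x, exists F, frames E F /\ fr_dom F x &
      forall F F', frames E F -> frames E F' -> forall i j r,
        CkC_on atlasM r (fr_dom F `&` fr_dom F')
          (fun x => fr_coo (l := F') j (fr_sec (l := F) i x))].

Definition is_hermitian (E : cliffordData) : Prop :=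
  [/\ forall x (a : C) (u v w : E x),
        herm (a *: u + v) w = a * herm u w + herm v w,
      forall x (v w : E x), herm v w = (herm w v)^*,
      forall x (v : E x), v != 0 -> 0 < herm v v &
      forall F, frames E F -> forall i j r,
        CkC_on atlasM r (fr_dom F)
          (fun x => herm (fr_sec (l := F) i x) (fr_sec (l := F) j x))].

Definition is_grading (E : cliffordData) : Prop :=
  [/\ forall x, linear (@grading E x),
      forall x (v : E x), grading (grading v) = v,
      forall x (v w : E x), herm (grading v) w = herm v (grading w) &
      forall r, Ck_endo r (@grading E)].

(* Clifford multiplication, with the convention c(v)^2 = - |v|^2 and c(v)
   skew-adjoint *)
Definition is_clifford_mult (E : cliffordData) : Prop :=
  [/\ forall x (v : tangent x), linear (@cliff E x v),
      forall x (a : R) (v w : tangent x) (e : E x),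
        cliff (a *: v + w) e = a%:C *: cliff v e + cliff w e,
      forall x (v : tangent x) (e : E x),
        cliff v (cliff v e) = - (metric (gmetric M) v v)%:C *: e,
      forall x (v : tangent x) (e f : E x),
        herm (cliff v e) f = - herm e (cliff v f) &
      (forall x (v : tangent x) (e : E x),
         grading (cliff v e) = - cliff v (grading e)) /\
      (forall c i, atlasM c -> forall F, frames E F -> forall a b r,
         CkC_on atlasM r (chart_dom c `&` fr_dom F)
           (fun x => fr_coo (l := F) a
              (cliff (coord_vec c i x) (fr_sec (l := F) b x))))].

Definition is_connection (E : cliffordData) : Prop :=
  [/\ forall x (a : R) (v w : tangent x) (s : section_of E), Ck_section 1 s ->
        nab (a *: v + w) s = a%:C *: nab v s + nab w s,
      forall x (v : tangent x) (s t : section_of E),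
        Ck_section 1 s -> Ck_section 1 t ->
        nab v (fun y => s y + t y) = nab v s + nab v t,
      forall x (v : tangent x) (f : M -> C) (s : section_of E),
        CkM 1 f -> Ck_section 1 s ->
        nab v (fun y => f y *: s y) = dcomplex f v *: s x + f x *: nab v s &
      forall (X : vfield M) (s : section_of E),
        (forall r, Ck_vfield r X) -> (forall r, Ck_section r s) ->
        forall r, Ck_section r (fun x => nab (X x) s)].

Definition is_clifford_connection (E : cliffordData) : Prop :=
  [/\ is_connection E,
      forall x (v : tangent x) (s t : section_of E),
        Ck_section 1 s -> Ck_section 1 t ->
        dcomplex (fun y => herm (s y) (t y)) v =
          herm (nab v s) (t x) + herm (s x) (nab v t),
      forall x (v : tangent x) (s : section_of E), Ck_section 1 s ->
        nab v (fun y => grading (s y)) = grading (nab v s) &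
      exists nabLC : forall x : M, tangent x -> vfield M -> tangent x,
        is_levi_civita (gmetric M) nabLC /\
        forall x (v : tangent x) (Y : vfield M) (s : section_of E),
          (forall r, Ck_vfield r Y) -> Ck_section 1 s ->
          nab v (fun y => cliff (Y y) (s y)) =
            cliff (nabLC x v Y) (s x) + cliff (Y x) (nab v s)].

Definition total_pt (E : cliffordData) (x : M) (v : E x) : {y : M & E y} :=
  existT (fun y => E y : Type) x v.

(* The group law is stated in the total space of E. The section t in the last
   clause is the translate of s by g. *)
Definition is_equivariant (E : cliffordData) : Prop :=
  [/\ (forall g x, linear (@gact E g x)) /\
      (forall F F', frames E F -> frames E F' -> forall i j r,
         CkC_on (prod_atlas (@atlas R k G) atlasM) r
           [set p | fr_dom F p.2 /\ fr_dom F' (act p.1 p.2)]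
           (fun p : G * M =>
              fr_coo (l := F') j (gact p.1 (fr_sec (l := F) i p.2)))),
      (forall x (v : E x), total_pt (gact 1%g v) = total_pt v) /\
      (forall g h x (v : E x),
         total_pt (gact (g * h)%g v) = total_pt (gact g (gact h v))),
      (forall g x (v w : E x), herm (gact g v) (gact g w) = herm v w) /\
      (forall g x (v : E x), grading (gact g v) = gact g (grading v)),
      forall g x (v : tangent x) (e : E x),
        cliff (dmap (act g) v) (gact g e) = gact g (cliff v e) &
      forall g (s t : section_of E), Ck_section 1 s ->
        (forall x, t (act g x) = gact g (s x)) ->
        forall x (v : tangent x), nab (dmap (act g) v) t = gact g (nab v s)].

Definition is_graded_gclifford (E : cliffordData) : Prop :=
  [/\ is_vector_bundle E, is_hermitian E /\ is_grading E, is_clifford_mult E,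
      is_clifford_connection E & is_equivariant E].

Record gCliffordBundle := GCliffordBundle {
  gcb_data :> cliffordData;
  gcb_axioms : is_graded_gclifford gcb_data }.

(* The composition of the connection, the isomorphism from the cotangent to
   the tangent bundle, and Clifford multiplication: in an orthonormal basis it
   is the sum of the cliff e_i (nab e_i s). *)
Definition dirac (E : cliffordData) (s : section_of E) : section_of E :=
  fun x => \sum_i \sum_j (cometric (gmetric M) x i j)%:C *:
             cliff (basis_vec x i) (nab (basis_vec x j) s).

Definition is_admissible (E : gCliffordBundle) (Phi : forall x : M, E x -> E x)
    : Prop :=
  [/\ (forall x, linear (Phi x)) /\ Ck_endo 1 Phi,
      forall x (v : E x), Phi x (grading v) = - grading (Phi x v),
      forall g x (v : E x), Phi (act g x) (gact g v) = gact g (Phi x v),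
      forall x (v w : E x), herm (Phi x v) w = herm v (Phi x w) &
      exists A : forall x : M, E x -> E x,
        [/\ (forall x, linear (A x)) /\ Ck_endo 0 A,
            forall s : section_of E, Ck_section 1 s -> forall x,
              Phi x (dirac s x) + dirac (fun y => Phi y (s y)) x = A x (s x),
            exists B : R, forall x (v : E x),
              herm (A x v) (A x v) <= B%:C * herm v v &
            exists (K : set M) (c : R), [/\ cocompact K, 0 < c &
              forall x, ~ K x -> forall v : E x,
                c%:C * herm v v <= herm (A x v + Phi x (Phi x v)) v]]].

Section Twist.
Variables (E : cliffordData) (l : nat).

(* V (x) C^m is {ffun 'I_m -> V}, where v (x) w is the function mapping i to
   w_i v; tens_endo T A is T (x) A. *)
Definition tens_endo (V : lmodType C) (m : nat) (T : V -> V) (A : 'M[C]_m)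
    (s : {ffun 'I_m -> V}) : {ffun 'I_m -> V} :=
  [ffun i => \sum_j A i j *: T (s j)].

Definition twist_fiber (x : M) : lmodType C := {ffun 'I_(l + l) -> E x}.

Definition twist_frame (F : local_frame E) : local_frame twist_fiber :=
  @LocalFrame twist_fiber (fr_dom F) #|{: 'I_(fr_rank F) * 'I_(l + l)}|
    (fun p x => [ffun j => if j == (enum_val p).2
                           then fr_sec (l := F) (enum_val p).1 x else 0])
    (fun p x v => fr_coo (l := F) (enum_val p).1 (v (enum_val p).2)).

(* E (x) (C^l (+) (C^l)^op), where C^l (+) (C^l)^op is C^(l + l) graded by
   diag(1, -1), with the trivial connection and the trivial action of G *)
Definition twist_data : cliffordData := {|
  fiber := twist_fiber;
  frames := twist_frame @` frames E;
  herm := fun x v w => \sum_i herm (v i) (w i);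
  grading := fun x =>
    tens_endo (@grading E x) (block_mx 1%:M 0 0 (- 1%:M));
  cliff := fun x v e => [ffun i => cliff v (e i)];
  nab := fun x v s => [ffun i => nab v (fun y => s y i)];
  gact := fun g x e => [ffun i => gact g (e i)] |}.

End Twist.

End CliffordBundles.

Arguments frames {R k n G M} c _.

Section CkTheory.
Context {R : realType} {V W : normedModType R}.

Lemma near_eq_differentiable (f g : V -> W) (x : V) :
  (\near x, f x = g x) -> differentiable f x -> differentiable g x.
Proof.
move=> fg df.
pose h : V -> W := g - f.
have h0 : h \o shift x = cst (h x) + (\0 : V -> W) +o_0 id.
  apply/eqaddoP => e e0.
  have hx : h x = 0 by rewrite /h !fctE (nbhs_singleton fg) subrr.
  have sh : \forall y \near (0 : V), f (y + x) = g (y + x).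
    have sc : (fun y => y + x) y @[y --> (0 : V)] --> x.
      by rewrite -[X in _ --> X]add0r; apply: cvgD; [exact: cvg_id|exact: cvg_cst].
    exact: (sc _ fg).
  apply: filterS sh => y fgy.
  rewrite !fctE /= hx /h !fctE fgy subrr !addr0 subr0 normr0.
  by rewrite mulr_ge0// ltW.
have dh : differentiable h x.
  have E := @diff_unique R V W h \0 x (fun u => cvg_cst 0) h0.
  apply/diff_locallyP; rewrite E; split => //.
  by move=> u; exact: cvg_cst.
rewrite (_ : g = f + h); first exact: differentiableD.
by apply/funext => y; rewrite /h !fctE addrC subrK.
Qed.

Lemma Ck_ext (r : nat) (A : set V) (f g : V -> W) : open A ->
  (forall x, A x -> f x = g x) -> Ck r A f -> Ck r A g.
Proof.
move=> oA; elim: r f g => [|r IH] f g fg /=.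
  move=> fc x Ax; have nfg : \near x, f x = g x.
    by apply: filterS fg _; exact: open_nbhs_nbhs.
  have fcx := fc x Ax; rewrite /prop_for /continuous_at -(fg _ Ax).
  by apply: cvg_trans fcx; exact: near_eq_cvg.
move=> [df Df]; split.
  move=> x Ax; apply: near_eq_differentiable (df x Ax).
  by apply: filterS fg _; exact: open_nbhs_nbhs.
move=> v; apply: IH (Df v) => x Ax; apply: near_eq_derive.
by apply: filterS fg _; exact: open_nbhs_nbhs.
Qed.

Lemma Ck_cst (r : nat) (A : set V) (a : W) : Ck r A (cst a).
Proof.
elim: r a => [|r IH] a /=; first by move=> x _; exact: cvg_cst.
split=> [x _|v]; first exact: differentiable_cst.
by rewrite (_ : 'D_v _ = cst 0)//; apply/funext => x; rewrite derive_cst.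
Qed.

Lemma CkN (r : nat) (A : set V) (f : V -> W) : open A ->
  Ck r A f -> Ck r A (- f).
Proof.
move=> oA; elim: r f => [|r IH] f /=.
  by move=> fc x Ax; apply: continuousN; exact: fc.
move=> [df Df]; split=> [x /df|v]; first exact: differentiableN.
apply: Ck_ext (IH _ (Df v)) => // x Ax; rewrite deriveN//.
exact/diff_derivable/df.
Qed.

Lemma Ck_continuous r (A : set V) (f : V -> W) x :
  Ck r A f -> A x -> {for x, continuous f}.
Proof.
case: r => [|r] /=; first exact.
by move=> [df _] Ax; exact/differentiable_continuous/df.
Qed.

End CkTheory.

Section CkOnTheory.
Context {R : realType} {n : nat} {T : topologicalType}.

Definition good_atlas (A : set (chart R n T)) : Prop :=
  forall c, A c -> forall D, open D ->
    open (chart_img c `&` chart_inv c @^-1` D).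

Lemma open_chart_inv (I : set 'rV[R]_n) (f : 'rV[R]_n -> T) (D : set T) :
  open I -> (forall u, I u -> {for u, continuous f}) -> open D ->
  open (I `&` f @^-1` D).
Proof.
move=> oI fc oD; rewrite openE => u [Iu Du]; apply: filterI.
  exact: open_nbhs_nbhs.
by apply: (fc u Iu); exact: open_nbhs_nbhs.
Qed.

Variable A : set (chart R n T).
Hypothesis Ag : good_atlas A.

Lemma Ck_on_ext (W : normedModType R) r (D : set T) (f g : T -> W) : open D ->
  (forall x, D x -> f x = g x) -> Ck_on A r D f -> Ck_on A r D g.
Proof.
move=> oD fg fC c Ac; apply: Ck_ext (fC c Ac); first exact: Ag.
by move=> u [_ Du]; exact: fg.
Qed.

Lemma CkC_on_ext r (D : set T) (f g : T -> R[i]) : open D ->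
  (forall x, D x -> f x = g x) -> CkC_on A r D f -> CkC_on A r D g.
Proof.
move=> oD fg [f1 f2]; split.
  by apply: Ck_on_ext f1 => // x Dx; rewrite fg.
by apply: Ck_on_ext f2 => // x Dx; rewrite fg.
Qed.

Lemma CkC_on_cst r (D : set T) (a : R[i]) : CkC_on A r D (fun=> a).
Proof. by split=> c _; exact: Ck_cst. Qed.

Lemma CkC_onN r (D : set T) (f : T -> R[i]) : open D ->
  CkC_on A r D f -> CkC_on A r D (fun x => - f x).
Proof.
move=> oD [f1 f2]; split=> c Ac.
  rewrite (_ : _ \o _ = - ((fun x => complex.Re (f x)) \o chart_inv c)).
    by apply: CkN; [exact: Ag|exact: f1].
  by apply/funext => u; rewrite !fctE/=; case: (f _).
rewrite (_ : _ \o _ = - ((fun x => complex.Im (f x)) \o chart_inv c)).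
  by apply: CkN; [exact: Ag|exact: f2].
by apply/funext => u; rewrite !fctE/=; case: (f _).
Qed.

End CkOnTheory.

Section GoodAtlas.
Context {R : realType}.

Lemma atlas_good n (M : manifoldType R n) : good_atlas (@atlas R n M).
Proof.
move=> c Ac D oD; have [[_ oI] _ _ _ ic] := @atlas_chart R n M c Ac.
exact: open_chart_inv.
Qed.

Lemma prod_atlas_good n m (M : manifoldType R n) (N : manifoldType R m) :
  good_atlas (prod_atlas (@atlas R n M) (@atlas R m N)).
Proof.
move=> _ [a Aa [b Ab <-]] D oD.
have [[_ oI] _ _ _ ic] := @atlas_chart R n M a Aa.
have [[_ oJ] _ _ _ jc] := @atlas_chart R m N b Ab.
have lc (u : 'rV[R]_(n + m)) : {for u, continuous (@lsubmx R 1 n m)}.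
  exact/differentiable_continuous/differentiable_lsubmx.
have rc (u : 'rV[R]_(n + m)) : {for u, continuous (@rsubmx R 1 n m)}.
  exact/differentiable_continuous/differentiable_rsubmx.
apply: open_chart_inv => //.
- rewrite openE => u [Iu Ju]; apply: filterI.
    apply: (lc u (chart_img a)); exact: open_nbhs_nbhs.
  apply: (rc u (chart_img b)); exact: open_nbhs_nbhs.
- move=> u [Iu Ju].
  exact: (cvg_pair (continuous_comp (lc u) (ic _ Iu))
                   (continuous_comp (rc u) (jc _ Ju))).
Qed.

End GoodAtlas.

Section DiffC.
Context {R : realType} {V : normedModType R}.
Implicit Types f g : V -> R[i].

Definition diffC f (u : V) : Prop :=
  differentiable (fun x => complex.Re (f x) : R) u /\
  differentiable (fun x => complex.Im (f x) : R) u.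

Lemma diffC_ext f g u : (\near u, f u = g u) -> diffC f u -> diffC g u.
Proof.
move=> fg [f1 f2]; split.
  by apply: near_eq_differentiable f1; apply: filterS fg => x ->.
by apply: near_eq_differentiable f2; apply: filterS fg => x ->.
Qed.

Lemma diffC_add f g u : diffC f u -> diffC g u ->
  diffC (fun x => f x + g x) u.
Proof.
move=> [f1 f2] [g1 g2]; split.
  rewrite (_ : (fun _ => _) =
    (fun x => complex.Re (f x)) + (fun x => complex.Re (g x))).
    exact: differentiableD.
  by apply/funext => x; rewrite !fctE; case: (f x) (g x) => [? ?] [].
rewrite (_ : (fun _ => _) =
  (fun x => complex.Im (f x)) + (fun x => complex.Im (g x))).
  exact: differentiableD.
by apply/funext => x; rewrite !fctE; case: (f x) (g x) => [? ?] [].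
Qed.

Lemma diffC_mul f g u : diffC f u -> diffC g u ->
  diffC (fun x => f x * g x) u.
Proof.
move=> [f1 f2] [g1 g2]; split.
  rewrite (_ : (fun _ => _) =
    (fun x => complex.Re (f x)) * (fun x => complex.Re (g x)) -
    (fun x => complex.Im (f x)) * (fun x => complex.Im (g x))).
    by apply: differentiableB; exact: differentiableM.
  by apply/funext => x; rewrite !fctE; case: (f x) (g x) => [? ?] [].
rewrite (_ : (fun _ => _) =
  (fun x => complex.Re (f x)) * (fun x => complex.Im (g x)) +
  (fun x => complex.Im (f x)) * (fun x => complex.Re (g x))).
  by apply: differentiableD; exact: differentiableM.
by apply/funext => x; rewrite !fctE; case: (f x) (g x) => [? ?] [].
Qed.

Lemma diffC_conj f u : diffC f u -> diffC (fun x => (f x)^*) u.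
Proof.
move=> [f1 f2]; split.
  rewrite (_ : (fun _ => _) = (fun x => complex.Re (f x)))//.
  by apply/funext => x; case: (f x).
rewrite (_ : (fun _ => _) = - (fun x => complex.Im (f x))).
  exact: differentiableN.
by apply/funext => x; rewrite !fctE; case: (f x).
Qed.

Lemma diffC_sum m (f : 'I_m -> V -> R[i]) u : (forall i, diffC (f i) u) ->
  diffC (fun x => \sum_i f i x) u.
Proof.
elim: m f => [|m IH] f df.
  rewrite (_ : (fun _ => _) = cst 0).
    by split; exact: differentiable_cst.
  by apply/funext => x; rewrite big_ord0.
rewrite (_ : (fun _ => _) =
  fun x => (\sum_(i < m) f (widen_ord (leqnSn m) i) x) + f ord_max x).
  by apply: diffC_add => //; apply: IH.
by apply/funext => x; rewrite big_ord_recr.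
Qed.

End DiffC.

Section DcomplexSum.
Context {R : realType} {n : nat} {M : manifoldType R n}.

Lemma dcomplex_sum m (f : 'I_m -> M -> R[i]) (x : M) (v : tangent x) :
  (forall i, diffC (f i \o chart_inv (chart_at x)) (chart_at x x)) ->
  dcomplex (fun y => \sum_i f i y) v = \sum_i dcomplex (f i) v.
Proof.
move=> df; rewrite /dcomplex /dreal.
have ReS (I : Type) (r : seq I) (F : I -> R[i]) :
    complex.Re (\sum_(i <- r) F i) = \sum_(i <- r) complex.Re (F i).
  by apply: (big_morph (@complex.Re R)) => // -[? ?] [].
have ImS (I : Type) (r : seq I) (F : I -> R[i]) :
    complex.Im (\sum_(i <- r) F i) = \sum_(i <- r) complex.Im (F i).
  by apply: (big_morph (@complex.Im R)) => // -[? ?] [].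
have -> : (fun y => complex.Re (\sum_i f i y)) \o chart_inv (chart_at x) =
    \sum_i ((fun y => complex.Re (f i y)) \o chart_inv (chart_at x)).
  by apply/funext => u; rewrite fct_sumE /= ReS.
have -> : (fun y => complex.Im (\sum_i f i y)) \o chart_inv (chart_at x) =
    \sum_i ((fun y => complex.Im (f i y)) \o chart_inv (chart_at x)).
  by apply/funext => u; rewrite fct_sumE /= ImS.
rewrite !derive_sum; last 2 first.
- by move=> i; apply: diff_derivable; case: (df i).
- by move=> i; apply: diff_derivable; case: (df i).
apply/eqP; rewrite eq_complex /= ReS ImS.
by apply/andP; split; apply/eqP; apply: eq_bigr.
Qed.

Lemma CkC_on_diffC r (D : set M) (f : M -> R[i]) (x : M) :
  CkC_on (@atlas R n M) r.+1 D f -> D x ->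
  diffC (f \o chart_inv (chart_at x)) (chart_at x x).
Proof.
move=> [f1 f2] Dx.
have [Ac xc] := svalP (cid (@atlas_cover R n M x)).
have [_ ci _ _ _] := @atlas_chart R n M _ Ac.
have [Ix ix] := ci x xc.
have Ax : (chart_img (chart_at x) `&` chart_inv (chart_at x) @^-1` D)
    (chart_at x x).
  by split => //=; rewrite /chart_at ix.
split; [exact: (f1 _ Ac).1|exact: (f2 _ Ac).1].
Qed.

End DcomplexSum.

Section TwistAxioms.
Context {R : realType} {k n : nat} {G : lieGroupType R k}.
Context {M : gRiemannian n G}.
Variables (E : gCliffordBundle M) (l : nat).

Local Notation C := R[i].
Local Notation tw := (twist_data E l).
Local Notation m := (l + l)%N.

Let Evb : is_vector_bundle E. Proof. by case: (gcb_axioms E). Qed.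
Let Ehm : is_hermitian E. Proof. by case: (gcb_axioms E) => _ []. Qed.
Let Egr : is_grading E. Proof. by case: (gcb_axioms E) => _ []. Qed.
Let Ecl : is_clifford_mult E. Proof. by case: (gcb_axioms E). Qed.
Let Ecn : is_clifford_connection E. Proof. by case: (gcb_axioms E). Qed.
Let Eeq : is_equivariant E. Proof. by case: (gcb_axioms E). Qed.

Let frP F : frames E F -> is_frame F. Proof. by case: Evb => + _ _; apply. Qed.
Let fr_open F : frames E F -> open (fr_dom F). Proof. by case/frP. Qed.

Lemma coo_lin F x (a : C) (v w : E x) i : frames E F -> fr_dom F x ->
  fr_coo (l := F) i (a *: v + w) =
  a * fr_coo (l := F) i v + fr_coo (l := F) i w.
Proof.
move=> /frP[_ /[apply]] [Hv Hc].
rewrite {1}(Hv v) {1}(Hv w) scaler_sumr -big_split /=.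
under eq_bigr do rewrite scalerA -scalerDl.
exact: (Hc (fun i => a * fr_coo (l := F) i v + fr_coo (l := F) i w)).
Qed.

Lemma coo0 F x i : frames E F -> fr_dom F x ->
  fr_coo (l := F) i (0 : E x) = 0.
Proof.
move=> FE Fx; have := coo_lin 1 0 0 i FE Fx.
by rewrite scale1r addr0 mul1r => /esym/eqP; rewrite -subr_eq0 addrK => /eqP.
Qed.

Lemma cooZ F x a (v : E x) i : frames E F -> fr_dom F x ->
  fr_coo (l := F) i (a *: v) = a * fr_coo (l := F) i v.
Proof.
by move=> FE Fx; have := coo_lin a v 0 i FE Fx; rewrite addr0 coo0// addr0.
Qed.

Let hermL x (a : C) (u v w : E x) :
  herm (a *: u + v) w = a * herm u w + herm v w.
Proof. by case: Ehm. Qed.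

Let hermC x (v w : E x) : herm v w = (herm w v)^*.
Proof. by case: Ehm. Qed.

Let herm0l x (w : E x) : herm 0 w = 0.
Proof.
have := hermL 1 0 0 w.
by rewrite scale1r addr0 mul1r => /esym/eqP; rewrite -subr_eq0 addrK => /eqP.
Qed.

Let herm0r x (w : E x) : herm w 0 = 0.
Proof. by rewrite hermC herm0l rmorph0. Qed.

Let hermDl x (u v w : E x) : herm (u + v) w = herm u w + herm v w.
Proof. by rewrite -[u]scale1r hermL mul1r scale1r. Qed.

Let hermZl x a (u w : E x) : herm (a *: u) w = a * herm u w.
Proof. by rewrite -[a *: u]addr0 hermL herm0l addr0. Qed.

Let hermDr x (u v w : E x) : herm w (u + v) = herm w u + herm w v.
Proof. by rewrite hermC hermDl rmorphD /= -!hermC. Qed.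

Let hermZr x a (u w : E x) : herm w (a *: u) = a^* * herm w u.
Proof. by rewrite hermC hermZl rmorphM /= -hermC. Qed.

Let herm_suml x (I : Type) (r : seq I) (F : I -> E x) w :
  herm (\sum_(i <- r) F i) w = \sum_(i <- r) herm (F i) w.
Proof. by apply: (big_morph (fun v => herm v w)) => // u v; rewrite hermDl. Qed.

Let herm_sumr x (I : Type) (r : seq I) (F : I -> E x) w :
  herm w (\sum_(i <- r) F i) = \sum_(i <- r) herm w (F i).
Proof. by apply: (big_morph (fun v => herm w v)) => // u v; rewrite hermDr. Qed.

Let sec_comp r (s : section_of tw) i : Ck_section r s ->
  Ck_section r (fun y => s y i : E y).
Proof.
move=> Cs F FE a.
have := Cs _ (ex_intro2 _ _ F FE erefl) (enum_rank (a, i)).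
by rewrite /= enum_rankK.
Qed.

Let sec_of_comp r (s : section_of tw) :
  (forall i, Ck_section r (fun y => s y i : E y)) -> Ck_section r s.
Proof. by move=> Cs _ [F FE <-] a /=; exact: Cs. Qed.

Lemma herm_diffC (s t : section_of E) (x : M) :
  Ck_section 1 s -> Ck_section 1 t ->
  diffC ((fun y => herm (s y) (t y)) \o chart_inv (chart_at x)) (chart_at x x).
Proof.
move=> Cs Ct; have [_ /(_ x)[F [FE Fx]] _] := Evb.
have [_ _ _ /(_ F FE) hF] := Ehm.
have [Ac xc] := svalP (cid (@atlas_cover R n M x)).
have [[_ oI] ci _ _ ic] := @atlas_chart R n M _ Ac.
have [Ix ix] := ci x xc.
set c := chart_at x.
have oF : open (chart_img c `&` chart_inv c @^-1` fr_dom F).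
  by apply: (@atlas_good R n M) => //; exact: fr_open.
apply: (@diffC_ext _ _ (fun u =>
   \sum_i \sum_j (fr_coo (l := F) i (s (chart_inv c u)) *
     (fr_coo (l := F) j (t (chart_inv c u)))^* *
     herm (fr_sec (l := F) i (chart_inv c u))
          (fr_sec (l := F) j (chart_inv c u))))).
  have : nbhs (c x) (chart_img c `&` chart_inv c @^-1` fr_dom F).
    by apply: open_nbhs_nbhs; split => //; split => //=; rewrite /c /chart_at ix.
  apply: filterS => u [_ /= Fu]; have [_ /(_ _ Fu)[Hv _]] := frP FE.
  rewrite [in RHS](Hv (s _)) [in RHS](Hv (t _)) herm_suml; apply: eq_bigr => i _.
  rewrite herm_sumr; apply: eq_bigr => j _.
  by rewrite hermZl hermZr mulrA.
apply: diffC_sum => i; apply: diffC_sum => j.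
apply: diffC_mul; last exact: CkC_on_diffC (hF i j 1) Fx.
apply: diffC_mul; first exact: CkC_on_diffC (Cs F FE i) Fx.
by apply: diffC_conj; exact: CkC_on_diffC (Ct F FE j) Fx.
Qed.

Lemma twist_vector_bundle : is_vector_bundle tw.
Proof.
have [_ cov trans] := Evb; split.
- move=> _ [F FE <-]; have [oF HF] := frP FE; split => //= x Fx.
  have [Hv Hc] := HF x Fx; split=> [v|a j].
  + apply/ffunP => i; rewrite sum_ffunE.
    rewrite (reindex_onto enum_rank enum_val) /=; last by move=> ? _; rewrite enum_valK.
    rewrite (eq_bigl xpredT); last by move=> p; rewrite /= enum_rankK eqxx.
    under eq_bigr do rewrite !ffunE enum_rankK.
    rewrite -(pair_bigA _ (fun a j => fr_coo (l := F) a (v j) *: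
       (if i == j then fr_sec (l := F) a x else 0))) /=.
    rewrite [LHS]Hv; apply: eq_bigr => a _.
    rewrite (bigD1 i)//= eqxx big1 ?addr0// => j ji.
    by rewrite eq_sym (negPf ji) scaler0.
  + case: (enum_val j) (enum_valK j) => b i jE.
    rewrite -jE {jE} /= sum_ffunE.
    rewrite (reindex_onto enum_rank enum_val) /=; last by move=> ? _; rewrite enum_valK.
    rewrite (eq_bigl xpredT); last by move=> p; rewrite /= enum_rankK eqxx.
    rewrite (eq_bigr (fun p => a (enum_rank (p.1, p.2)) *:
       (if i == p.2 then fr_sec (l := F) p.1 x else 0))); last first.
      by case=> ? ? _; rewrite !ffunE enum_rankK.
    rewrite -(pair_bigA _ (fun a' j => a (enum_rank (a', j)) *:
       (if i == j then fr_sec (l := F) a' x else 0))) /=.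
    under eq_bigr => a' _.
      rewrite (bigD1 i)//= eqxx big1 ?addr0; last first.
        by move=> j' ji; rewrite eq_sym (negPf ji) scaler0.
      over.
    exact: (Hc (fun a' => a (enum_rank (a', i)))).
- by move=> x; have [F [FE Fx]] := cov x; exists (twist_frame l F); split => //; exists F.
- move=> _ _ [F FE <-] [F' FE' <-] i j r /=.
  have oFF : open (fr_dom F `&` fr_dom F') by apply: openI; exact: fr_open.
  case ij: ((enum_val j).2 == (enum_val i).2).
    apply: CkC_on_ext (trans F F' FE FE' (enum_val i).1 (enum_val j).1 r) => //.
      exact: atlas_good.
    by move=> x _; rewrite ffunE ij.
  apply: CkC_on_ext (CkC_on_cst _ r _ 0) => //; first exact: atlas_good.
  by move=> x [_ Fx]; rewrite ffunE ij coo0.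
Qed.

Lemma twist_hermitian : is_hermitian tw.
Proof.
have [_ _ hpos hF] := Ehm; split.
- move=> x a u v w /=; rewrite mulr_sumr -big_split /=.
  by apply: eq_bigr => i _; rewrite !ffunE hermL.
- by move=> x v w /=; rewrite rmorph_sum; apply: eq_bigr => i _; exact: hermC.
- move=> x v v0 /=.
  have hge (w : E x) : 0 <= herm w w.
    by have [->|/hpos/ltW//] := eqVneq w 0; rewrite herm0l.
  rewrite lt0r sumr_ge0// andbT; apply: contra v0 => /eqP h0.
  have/psumr_eq0P H : forall i : 'I_m, true -> 0 <= herm (v i) (v i) by [].
  apply/eqP/ffunP => i; rewrite ffunE; apply/eqP; apply: contraT => vi.
  by have := hpos _ _ vi; rewrite (H h0 i)// ltxx.
- move=> _ [F FE <-] i j r /=.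
  case ij: ((enum_val j).2 == (enum_val i).2).
    rewrite (_ : (fun _ => _) = fun x => herm (fr_sec (l := F) (enum_val i).1 x)
                (fr_sec (l := F) (enum_val j).1 x)); first exact: hF.
    apply/funext => x; rewrite (bigD1 (enum_val i).2)//= !ffunE eqxx.
    rewrite eq_sym ij big1 ?addr0// => p pi.
    by rewrite !ffunE (negPf pi) herm0l.
  rewrite (_ : (fun _ => _) = fun=> 0); first exact: CkC_on_cst.
  apply/funext => x; rewrite big1// => p _; rewrite !ffunE.
  have [->|pi] := eqVneq p (enum_val i).2; last by rewrite herm0l.
  by rewrite eq_sym ij herm0r.
Qed.

Let gr_lin x (a : C) (u v : E x) :
  grading (a *: u + v) = a *: grading u + grading v.
Proof. by case: Egr => + _ _ _; apply. Qed.

Let gr0 x : grading (0 : E x) = 0.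
Proof.
have := @gr_lin x 1 0 0.
by rewrite !scale1r addr0 => /esym/eqP; rewrite -subr_eq0 addrK => /eqP.
Qed.

Let grZ x (a : C) (u : E x) : grading (a *: u) = a *: grading u.
Proof. by have := gr_lin a u 0; rewrite !addr0 gr0 addr0. Qed.

Let sgn (i : 'I_m) : C := if (i < l)%N then 1 else -1.

Let sgn_mx : block_mx 1%:M 0 0 (- 1%:M) = diag_mx (\row_i sgn i) :> 'M[C]_m.
Proof.
apply/matrixP => i j; rewrite !mxE.
case: splitP => i' iE; rewrite !mxE; case: splitP => j' jE; rewrite !mxE /sgn.
- rewrite iE ltn_ord -val_eqE /= -val_eqE /= iE jE.
  by case: eqP.
- rewrite -val_eqE /= iE jE; case: eqP => // ij.
  by have := ltn_ord i'; rewrite ij ltnNge leq_addr.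
- rewrite -val_eqE /= iE jE; case: eqP => // ij.
  by have := ltn_ord j'; rewrite -ij ltnNge leq_addr.
- rewrite iE ltnNge leq_addr -val_eqE /= -val_eqE /= iE jE eqn_add2l.
  by case: eqP => //= _; rewrite ?mulrN1z ?mulr0n ?oppr0.
Qed.

Lemma twist_gradingE x (v : tw x) i :
  @grading _ _ _ _ _ tw x v i = sgn i *: grading (v i : E x).
Proof.
rewrite /= ffunE sgn_mx (bigD1 i)//= big1 ?addr0 => [|j ji].
  by rewrite !mxE eqxx mulr1n.
by rewrite !mxE eq_sym (negPf ji) mulr0n scale0r.
Qed.

Let sgn_sq i : sgn i * sgn i = 1.
Proof. by rewrite /sgn; case: ifP; rewrite ?mul1r ?mulrNN ?mul1r. Qed.

Let sgn_conj i : (sgn i)^* = sgn i.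
Proof. by rewrite /sgn; case: ifP; rewrite ?rmorphN rmorph1. Qed.

Lemma twist_grading : is_grading tw.
Proof.
have [_ gr2 grh grC] := Egr; split.
- move=> x a u v; apply/ffunP => i.
  have -> : (a *: (grading u : tw x) + grading v) i =
      a *: ((grading u : tw x) i) + (grading v : tw x) i.
    by rewrite !ffunE.
  rewrite !twist_gradingE !ffunE gr_lin scalerDr.
  by rewrite !scalerA mulrC.
- move=> x v; apply/ffunP => i.
  by rewrite !twist_gradingE grZ gr2 scalerA sgn_sq scale1r.
- move=> x v w; rewrite [LHS]/= [RHS]/=; apply: eq_bigr => i _.
  by rewrite !twist_gradingE hermZl hermZr grh sgn_conj.
- move=> r _ [F FE <-] i j.
  rewrite [X in CkC_on _ _ X]/= /twist_frame /=.
  set i' := enum_val i; set j' := enum_val j.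
  have Fo := fr_open FE.
  case ij: (i'.2 == j'.2); last first.
    apply: CkC_on_ext (CkC_on_cst _ r _ 0) => //; first exact: atlas_good.
    move=> x Fx; have := @twist_gradingE x.
    by move=> /= ->; rewrite ffunE ij gr0 scaler0 coo0.
  have K := grC r F FE i'.1 j'.1.
  case sg: (i'.2 < l)%N.
    apply: CkC_on_ext K => //; first exact: atlas_good.
    move=> x Fx; have := @twist_gradingE x.
    by move=> /= ->; rewrite ffunE ij /sgn sg scale1r.
  apply: CkC_on_ext (CkC_onN _ Fo K) => //; [exact: atlas_good| |exact: atlas_good].
  move=> x Fx; have := @twist_gradingE x.
  by move=> /= ->; rewrite ffunE ij /sgn sg cooZ// mulN1r.
Qed.

Lemma twist_clifford_mult : is_clifford_mult tw.
Proof.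
have [cl1 cl2 cl3 cl4 [cl5 cl6]] := Ecl.
have cl0 x (v : tangent x) : cliff v (0 : E x) = 0.
  have := cl1 x v 1 0 0.
  by rewrite !scale1r addr0 => /esym/eqP; rewrite -subr_eq0 addrK => /eqP.
have clZ x (v : tangent x) a (u : E x) : cliff v (a *: u) = a *: cliff v u.
  by have := cl1 x v a u 0; rewrite !addr0 cl0 addr0.
split.
- by move=> x v a u w; apply/ffunP => i; rewrite !ffunE cl1.
- by move=> x a v w e; apply/ffunP => i; rewrite !ffunE cl2.
- by move=> x v e; apply/ffunP => i; rewrite !ffunE cl3.
- move=> x v e f; rewrite /= -sumrN; apply: eq_bigr => i _.
  by rewrite !ffunE cl4.
- split.
    move=> x v e; apply/ffunP => i.
    rewrite [RHS]ffunE twist_gradingE [in RHS]ffunE twist_gradingE !ffunE cl5 clZ.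
    by rewrite scalerN.
  move=> c p Ac _ [F FE <-] a b r /=.
  have oD : open (chart_dom c `&` fr_dom F).
    apply: openI; last exact: fr_open.
    by have [[]] := @atlas_chart R n M _ Ac.
  case ij: ((enum_val a).2 == (enum_val b).2).
    apply: CkC_on_ext (cl6 c p Ac F FE (enum_val a).1 (enum_val b).1 r) => //.
      exact: atlas_good.
    by move=> x _; rewrite !ffunE ij.
  apply: CkC_on_ext (CkC_on_cst _ r _ 0) => //; first exact: atlas_good.
  by move=> x [_ Fx]; rewrite !ffunE ij cl0 coo0.
Qed.

Lemma twist_clifford_connection : is_clifford_connection tw.
Proof.
have [[cn1 cn2 cn3 cn4] cnh cng [nabLC [HLC cnc]]] := Ecn.
have nabE x (v : tangent x) (s : section_of tw) i :
  @nab _ _ _ _ _ tw x v s i = nab v (fun y => s y i : E y) by rewrite ffunE.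
split; [split| | |exists nabLC; split => //].
- move=> x a v w s Cs; apply/ffunP => i.
  by rewrite nabE !ffunE cn1//; exact: sec_comp.
- move=> x v s t Cs Ct; apply/ffunP => i.
  rewrite nabE !ffunE -cn2; [|exact: sec_comp..].
  by congr nab; apply: functional_extensionality_dep => y; rewrite ffunE.
- move=> x v f s Cf Cs; apply/ffunP => i.
  rewrite nabE !ffunE -cn3//; last exact: sec_comp.
  by congr nab; apply: functional_extensionality_dep => y; rewrite ffunE.
- move=> X s CX Cs r; apply: sec_of_comp => i.
  have := cn4 X (fun y => s y i) CX (fun r => sec_comp i (Cs r)) r.
  by congr Ck_section; apply: functional_extensionality_dep => y; rewrite ffunE.
- move=> x v s t Cs Ct /=.
  rewrite dcomplex_sum => [|i]; last by apply: herm_diffC; exact: sec_comp.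
  rewrite -big_split /=; apply: eq_bigr => i _; rewrite !ffunE cnh//; exact: sec_comp.
- move=> x v s Cs; apply/ffunP => i.
  have Csi := sec_comp i Cs.
  rewrite nabE twist_gradingE nabE.
  have -> : (fun y => @grading _ _ _ _ _ tw y (s y) i) =
            fun y => grading (sgn i *: (s y i : E y)).
    by apply: functional_extensionality_dep => y; rewrite twist_gradingE grZ.
  have Csgn : Ck_section 1 (fun y => sgn i *: (s y i : E y)).
    move=> F FE a; have Fo := fr_open FE; have K := Csi F FE a.
    rewrite /sgn; case: ifP => _.
      apply: (CkC_on_ext _ Fo _ K); first exact: atlas_good.
      by move=> y Fy; rewrite scale1r.
    apply: (CkC_on_ext _ Fo _ (CkC_onN _ Fo K)); [exact: atlas_good| |exact: atlas_good].
    by move=> y Fy; rewrite cooZ// mulN1r.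
  rewrite cng// -grZ; congr grading.
  have Cc : @CkM R n M 1 (cst (sgn i)) by exact: CkC_on_cst.
  rewrite (cn3 x v _ _ Cc Csi) (_ : dcomplex _ v = 0) ?scale0r ?add0r//.
  apply/eqP; rewrite eq_complex /dcomplex /dreal /=.
  apply/andP; split; apply/eqP.
    exact: (derive_cst (complex.Re (sgn i))).
  exact: (derive_cst (complex.Im (sgn i))).
- move=> x v Y s CY Cs; apply/ffunP => i.
  rewrite nabE !ffunE -cnc//; last exact: sec_comp.
  by congr nab; apply: functional_extensionality_dep => y; rewrite ffunE.
Qed.

Lemma total_pt_ffun (x' x : M) (w : tw x') (v : tw x) : x' = x ->
  (forall i, total_pt (w i : E x') = total_pt (v i : E x)) ->
  total_pt w = total_pt v.
Proof.
move=> xE; subst x'; move=> H; congr (existT _ x); apply/ffunP => i.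
have p := projT2_eq (H i).
by move: p; rewrite (Prop_irrelevance (projT1_eq (H i)) erefl).
Qed.

Lemma twist_equivariant : is_equivariant tw.
Proof.
have [[ga1 ga2] [ga3 ga4] [ga5 ga6] ga7 ga8] := Eeq.
have ga0 g x : gact g (0 : E x) = 0.
  have := ga1 g x 1 0 0.
  by rewrite !scale1r addr0 => /esym/eqP; rewrite -subr_eq0 addrK => /eqP.
have gaZ g x a (u : E x) : gact g (a *: u) = a *: gact g u.
  by have := ga1 g x a u 0; rewrite !addr0 ga0 addr0.
split; [split|split|split| |].
- by move=> g x a u v; apply/ffunP => i; rewrite !ffunE ga1.
- move=> _ _ [F FE <-] [F' FE' <-] i j r /=.
  have oD : open [set p : G * M | fr_dom F p.2 /\ fr_dom F' (act p.1 p.2)].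
    apply: openI; apply: open_comp; [|exact: fr_open| |exact: fr_open].
      by move=> p _; exact: cvg_snd.
    by move=> p _; have [/(_ p)] := act_smooth M.
  case ij: ((enum_val j).2 == (enum_val i).2).
    apply: CkC_on_ext (ga2 F F' FE FE' (enum_val i).1 (enum_val j).1 r) => //.
      exact: prod_atlas_good.
    by move=> p _; rewrite !ffunE ij.
  apply: CkC_on_ext (CkC_on_cst _ r _ 0) => //; first exact: prod_atlas_good.
  by move=> p [_ Fp]; rewrite !ffunE ij ga0 coo0.
- move=> x v; apply: total_pt_ffun => [|i]; first exact: act1.
  by rewrite ffunE.
- move=> g h x v; apply: total_pt_ffun => [|i]; first exact: actM.
  by rewrite !ffunE.
- by move=> g x v w /=; apply: eq_bigr => i _; rewrite !ffunE ga5.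
- move=> g x v; apply/ffunP => i.
  have gE (w : tw x) : (gact g w : tw _) i = gact g (w i : E x).
    by rewrite ffunE.
  by rewrite twist_gradingE !gE ga6 twist_gradingE gaZ.
- by move=> g x v e; apply/ffunP => i; rewrite !ffunE ga7.
- move=> g s t Cs st x v; apply/ffunP => i; rewrite !ffunE.
  by apply: ga8 => [|y]; [exact: sec_comp|rewrite st ffunE].
Qed.

Lemma twist_axioms : is_graded_gclifford tw.
Proof.
split; [exact: twist_vector_bundle| |exact: twist_clifford_mult|
  exact: twist_clifford_connection|exact: twist_equivariant].
by split; [exact: twist_hermitian|exact: twist_grading].
Qed.

Definition twist : gCliffordBundle M := GCliffordBundle twist_axioms.

End TwistAxioms.

(* z (x) [[0, U^*], [U, 0]] *)
Definition corona_endo (R : realType) (k n : nat) (G : lieGroupType R k)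
    (M : gRiemannian n G) (E : gCliffordBundle M) (l : nat) (U : 'M[CbG M]_l)
    (x : M) (v : twist E l x) : twist E l x :=
  let Ux : 'M[R[i]]_l := \matrix_(i, j) U i j x in
  tens_endo (@grading _ _ _ _ _ E x)
    (block_mx 0 (map_mx Num.conj Ux)^T Ux 0) v.

(* Main.v *)
(** By the Leibniz rule, and since [z] commutes with the connection and
    anticommutes with Clifford multiplication, [Phi D + D Phi] contains no
    derivative of the section: it is the matrix of the [c(dB_ij) z], where [B]
    is the matrix of functions [[0, U^*], [U, 0]]. Its norm is bounded by the
    norms of the [dB_ij], which are bounded and vanish at infinity modulo [G].
    As [U_0] is unitary, [Phi^2 = B^2] differs from the identity by a matrix of
    functions vanishing at infinity modulo [G]. Outside a cocompact set the sum
    [Phi D + D Phi + Phi^2] is therefore at least [1/2]. *)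

Require Import Defs.
From HB Require Import structures.
From mathcomp Require Import all_boot all_order all_algebra.
From mathcomp Require Import complex.
From mathcomp Require Import all_classical all_reals all_analysis.
From mathcomp Require Import lra.

Set Implicit Arguments.
Unset Strict Implicit.
Unset Printing Implicit Defensive.

Import Order.TTheory GRing.Theory Num.Theory.
Import numFieldNormedType.Exports.

Local Open Scope classical_set_scope.
Local Open Scope complex_scope.
Local Open Scope ring_scope.

(** Two requirements go beyond the algebra of the overview. The anticommutator must be a continuous
    endomorphism, yet its building block, Clifford multiplication by a gradient, is written at each
    point in a chart chosen for that point. Continuity is recovered by expressing the gradient in
    the coordinate frame of one fixed chart, through the inverse Gram matrix and Cramer's rule.
    Moreover, the lower bound is stated in the order of [R[i]], where comparable numbers have equal
    imaginary parts; hence the anticommutator is also shown to be self-adjoint. The value 1/2 is an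
    error count. With [m = l + l] there are [m * m] matrix entries, each with one error from a
    differential and one from the square, all controlled by [d = 1 / (8 (m + 1))]. The total loss is
    at most [4 d m], which is below 1/2. *)

Section LinearMaps.
Variables (K : pzRingType) (V W : lmodType K) (T : V -> W).
Hypothesis Tl : linear T.

Lemma lin0 : T 0 = 0.
Proof.
have := Tl 1 0 0; rewrite !scale1r addr0 => /esym/eqP.
by rewrite -subr_eq0 addrK => /eqP.
Qed.

Lemma linZ a v : T (a *: v) = a *: T v.
Proof. by have := Tl a v 0; rewrite !addr0 lin0 addr0. Qed.

Lemma linD u v : T (u + v) = T u + T v.
Proof. by have := Tl 1 u v; rewrite !scale1r. Qed.

Lemma lin_sum (I : Type) (s : seq I) (F : I -> V) :
  T (\sum_(i <- s) F i) = \sum_(i <- s) T (F i).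
Proof. by apply: (big_morph T); [exact: linD|exact: lin0]. Qed.

End LinearMaps.

Section ComplexNumbers.
Context {R : realType}.

Lemma normcR (z : R[i]) : `|z| = (complex.Re `|z|)%:C.
Proof. by rewrite RRe_real// normr_real. Qed.

Lemma Re_conj (z : R[i]) : complex.Re z^* = complex.Re z.
Proof. by case: z. Qed.

Lemma Im_conj (z : R[i]) : complex.Im z^* = - complex.Im z.
Proof. by case: z. Qed.

Lemma conjC_real (a : R) : (a%:C)^* = a%:C :> R[i].
Proof. exact: conjc_real. Qed.

End ComplexNumbers.

(** * Algebra of C^k functions on open subsets of a normed space *)

Section CkAlgebra.
Context {R : realType} {V : normedModType R}.
Implicit Types (A : set V) (r : nat).

Lemma CkD (W : normedModType R) r A (f g : V -> W) : open A ->
  Ck r A f -> Ck r A g -> Ck r A (f + g).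
Proof.
move=> oA; elim: r f g => [|r IH] f g /=.
  by move=> fc gc x Ax; apply: continuousD; [exact: fc|exact: gc].
move=> [df Df] [dg Dg]; split=> [x Ax|v].
  by apply: differentiableD; [exact: df|exact: dg].
apply: Ck_ext (IH _ _ (Df v) (Dg v)) => // x Ax.
by rewrite deriveD//; apply/diff_derivable; [exact: df|exact: dg].
Qed.

Lemma Ck_pred (W : normedModType R) r A (f : V -> W) : Ck r.+1 A f -> Ck r A f.
Proof.
elim: r f => [|r IH] f.
  by move=> [df _] x Ax; exact/differentiable_continuous/df.
move=> [df Df]; split => // v; exact: IH (Df v).
Qed.

Lemma Ck_mul r A (f g : V -> R) : open A ->
  Ck r A f -> Ck r A g -> Ck r A (f * g).
Proof.
move=> oA; elim: r f g => [|r IH] f g.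
  by move=> fc gc x Ax; apply: continuousM; [exact: fc|exact: gc].
move=> fC gC; have [df Df] := fC; have [dg Dg] := gC; split=> [x Ax|v].
  by apply: differentiableM; [exact: df|exact: dg].
(* The Leibniz rule keeps one factor undifferentiated; [Ck_pred] lowers its class so that the
   induction hypothesis applies. *)
apply: Ck_ext (CkD oA (IH _ _ (Ck_pred fC) (Dg v))
  (IH _ _ (Ck_pred gC) (Df v))) => // x Ax.
by rewrite deriveM//; apply/diff_derivable; [exact: df|exact: dg].
Qed.

Lemma Ck_sum (I : Type) (s : seq I) (P : pred I) r A (f : I -> V -> R) :
  open A -> (forall i, Ck r A (f i)) ->
  Ck r A (fun x => \sum_(i <- s | P i) f i x).
Proof.
move=> oA fC; elim: s => [|i s IH].
  apply: (@Ck_ext R V R r A (cst 0)) => // [x _|]; last exact: Ck_cst.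
  by rewrite big_nil.
case Pi: (P i); last first.
  by apply: Ck_ext IH => // x _; rewrite big_cons Pi.
by apply: Ck_ext (CkD oA (fC i) IH) => // x _; rewrite big_cons Pi.
Qed.

Lemma Ck_prod (I : Type) (s : seq I) (P : pred I) r A (f : I -> V -> R) :
  open A -> (forall i, Ck r A (f i)) ->
  Ck r A (fun x => \prod_(i <- s | P i) f i x).
Proof.
move=> oA fC; elim: s => [|i s IH].
  apply: (@Ck_ext R V R r A (cst 1)) => // [x _|]; last exact: Ck_cst.
  by rewrite big_nil.
case Pi: (P i); last first.
  by apply: Ck_ext IH => // x _; rewrite big_cons Pi.
by apply: Ck_ext (Ck_mul oA (fC i) IH) => // x _; rewrite big_cons Pi.
Qed.

Lemma Ck_det m r A (F : V -> 'M[R]_m) : open A ->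
  (forall i j, Ck r A (fun x => F x i j : R)) ->
  Ck r A (fun x => \det (F x) : R).
Proof.
move=> oA FC; rewrite /determinant; apply: Ck_sum => // s.
apply: (@Ck_mul _ _ (cst _) (fun x => \prod_i F x i _)) => //; first exact: Ck_cst.
by apply: Ck_prod.
Qed.

(** Cramer's rule: the cofactors and the determinant are polynomials in the entries, and the
    determinant does not vanish. Class C^0 suffices, since the anticommutator need only be
    continuous. *)
Lemma C0_invmx m A (F : V -> 'M[R]_m) : open A ->
  (forall x, A x -> F x \in unitmx) ->
  (forall i j, Ck 0 A (fun x => F x i j : R)) ->
  forall i j, Ck 0 A (fun x => invmx (F x) i j : R).
Proof.
move=> oA FU FC i j.
pose h : V -> R := fun x => (\det (F x))^-1.
have hC : Ck 0 A h.
  move=> x Ax; apply: (@continuousV _ _ (fun x => \det (F x))).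
    by rewrite -unitfE -unitmxE; exact: FU.
  exact: (@Ck_det _ 0 A F oA FC).
apply: (@Ck_ext _ _ _ _ _ (h * (fun x => \adj (F x) i j : R)) _ oA).
  by move=> x Ax; rewrite /invmx FU// fctE [RHS]mxE.
apply: Ck_mul => //.
rewrite (_ : (fun _ => _) = cst ((-1) ^+ (j + i)) *
   (fun x => \det (row' j (col' i (F x))) : R)); last first.
  by apply/funext => x; rewrite mxE.
apply: Ck_mul => //; first exact: Ck_cst.
apply: Ck_det => // p q.
rewrite (_ : (fun _ => _) = fun x => F x (lift j p) (lift i q) : R)//.
by apply/funext => x; rewrite !mxE.
Qed.

Lemma Ck_sub (W : normedModType R) r A (B : set V) (f : V -> W) :
  B `<=` A -> Ck r A f -> Ck r B f.
Proof.
move=> BA; elim: r f => [|r IH] f /=; first by move=> fc x /BA; exact: fc.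
by move=> [df Df]; split=> [x /BA|v]; [exact: df|exact: IH].
Qed.

Definition CkC r A (f : V -> R[i]) : Prop :=
  Ck r A (fun x => complex.Re (f x) : R) /\ Ck r A (fun x => complex.Im (f x) : R).

Lemma CkC_ext r A (f g : V -> R[i]) : open A ->
  (forall x, A x -> f x = g x) -> CkC r A f -> CkC r A g.
Proof.
by move=> oA fg [f1 f2]; split;
  [apply: Ck_ext f1|apply: Ck_ext f2] => // x Ax; rewrite fg.
Qed.

Lemma CkC_cst r A (a : R[i]) : CkC r A (fun=> a).
Proof. by split; exact: Ck_cst. Qed.

Lemma CkC_sub r A (B : set V) (f : V -> R[i]) :
  B `<=` A -> CkC r A f -> CkC r B f.
Proof. by move=> BA [f1 f2]; split; exact: Ck_sub BA _. Qed.

Lemma CkC_real r A (f : V -> R) : Ck r A f -> CkC r A (fun x => (f x)%:C).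
Proof. by move=> fC; split => //; exact: Ck_cst. Qed.

Lemma CkC_conj r A (f : V -> R[i]) : open A -> CkC r A f ->
  CkC r A (fun x => (f x)^*).
Proof.
move=> oA [f1 f2]; split.
  by apply: Ck_ext f1 => // x _; case: (f x).
by apply: Ck_ext (CkN oA f2) => // x _; rewrite !fctE; case: (f x).
Qed.

Lemma CkC_add r A (f g : V -> R[i]) : open A ->
  CkC r A f -> CkC r A g -> CkC r A (fun x => f x + g x).
Proof.
move=> oA [f1 f2] [g1 g2]; split.
  by apply: Ck_ext (CkD oA f1 g1) => // x _; rewrite !fctE raddfD.
by apply: Ck_ext (CkD oA f2 g2) => // x _; rewrite !fctE raddfD.
Qed.

Lemma CkC_mul r A (f g : V -> R[i]) : open A ->
  CkC r A f -> CkC r A g -> CkC r A (fun x => f x * g x).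
Proof.
move=> oA [f1 f2] [g1 g2]; split.
  apply: Ck_ext (CkD oA (Ck_mul oA f1 g1) (CkN oA (Ck_mul oA f2 g2))) => // x _.
  by rewrite !fctE; case: (f x) (g x) => [? ?] [].
apply: Ck_ext (CkD oA (Ck_mul oA f1 g2) (Ck_mul oA f2 g1)) => // x _.
by rewrite !fctE; case: (f x) (g x) => [? ?] [].
Qed.

Lemma CkC_sum (I : Type) (s : seq I) r A (f : I -> V -> R[i]) : open A ->
  (forall i, CkC r A (f i)) -> CkC r A (fun x => \sum_(i <- s) f i x).
Proof.
move=> oA fC; elim: s => [|i s IH].
  by apply: CkC_ext (CkC_cst _ _ 0) => // x _; rewrite big_nil.
by apply: CkC_ext (CkC_add oA (fC i) IH) => // x _; rewrite big_cons.
Qed.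

End CkAlgebra.

(** * The same algebra for complex functions read through an atlas *)

Section CkOnAlgebra.
Context {R : realType} {n : nat} {T : topologicalType}.
Variable A : set (chart R n T).
Hypothesis Ag : good_atlas A.

Lemma CkC_onP r (D : set T) (f : T -> R[i]) :
  CkC_on A r D f <-> forall c, A c ->
    CkC r (chart_img c `&` chart_inv c @^-1` D) (f \o chart_inv c).
Proof.
split=> [[f1 f2] c Ac|fC]; first by split; [exact: f1|exact: f2].
by split=> c Ac; [exact: (fC c Ac).1|exact: (fC c Ac).2].
Qed.

Lemma CkC_on_sub r (D D' : set T) (f : T -> R[i]) :
  D' `<=` D -> CkC_on A r D f -> CkC_on A r D' f.
Proof.
move=> DD /CkC_onP fC; apply/CkC_onP => c Ac; apply: CkC_sub (fC c Ac).
by move=> u [Iu Du]; split => //; exact: DD.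
Qed.

Lemma CkC_onD r (D : set T) (f g : T -> R[i]) : open D ->
  CkC_on A r D f -> CkC_on A r D g -> CkC_on A r D (fun x => f x + g x).
Proof.
move=> oD /CkC_onP fC /CkC_onP gC; apply/CkC_onP => c Ac.
by apply: (CkC_add _ (fC c Ac) (gC c Ac)); exact: Ag.
Qed.

Lemma CkC_onM r (D : set T) (f g : T -> R[i]) : open D ->
  CkC_on A r D f -> CkC_on A r D g -> CkC_on A r D (fun x => f x * g x).
Proof.
move=> oD /CkC_onP fC /CkC_onP gC; apply/CkC_onP => c Ac.
by apply: (CkC_mul _ (fC c Ac) (gC c Ac)); exact: Ag.
Qed.

Lemma CkC_on_sum (I : Type) (s : seq I) r (D : set T) (f : I -> T -> R[i]) :
  open D -> (forall i, CkC_on A r D (f i)) ->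
  CkC_on A r D (fun x => \sum_(i <- s) f i x).
Proof.
move=> oD fC; elim: s => [|i s IH].
  by apply: (CkC_on_ext Ag oD _ (CkC_on_cst _ _ _ 0)) => x _; rewrite big_nil.
by apply: (CkC_on_ext Ag oD _ (CkC_onD oD (fC i) IH)) => x _; rewrite big_cons.
Qed.

End CkOnAlgebra.

(** * Gram matrix, gradient and norm of a differential *)

Section Gradient.
Context {R : realType} {n : nat} {M : manifoldType R n} (g : riemannian M).
Implicit Types (x : M) (u : M -> R).

(** The matrix whose inverse is [cometric]; with it, identities between metric and cometric become
    matrix algebra on row vectors. *)
Definition gram x : 'M[R]_n :=
  \matrix_(i, j) metric g (basis_vec x i) (basis_vec x j).

Lemma metric0l x (w : tangent x) : metric g 0 w = 0.
Proof.
have := metric_linear g 1 0 0 w.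
by rewrite scale1r addr0 mul1r => /esym/eqP; rewrite -subr_eq0 addrK => /eqP.
Qed.

Lemma metric_lin_sum x (I : Type) (s : seq I) (a : I -> R)
    (v : I -> tangent x) (w : tangent x) :
  metric g (\sum_(i <- s) a i *: v i) w = \sum_(i <- s) a i * metric g (v i) w.
Proof.
elim: s => [|i s IH]; first by rewrite !big_nil metric0l.
by rewrite !big_cons metric_linear IH.
Qed.

Lemma tangent_basisE x (v : tangent x) :
  v = \sum_i (v : 'rV[R]_n) 0 i *: basis_vec x i.
Proof. exact: (@row_sum_delta R n v). Qed.

Lemma metric_gramE x (v w : tangent x) :
  metric g v w = ((v : 'rV[R]_n) *m gram x *m (w : 'rV[R]_n)^T) 0 0.
Proof.
rewrite -mulmxA !mxE [in LHS](tangent_basisE v) metric_lin_sum.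
apply: eq_bigr => i _; congr (_ * _); rewrite Defs.metric_sym.
rewrite [in LHS](tangent_basisE w) metric_lin_sum !mxE.
by apply: eq_bigr => j _; rewrite Defs.metric_sym !mxE mulrC.
Qed.

Lemma gramT x : (gram x)^T = gram x.
Proof. by apply/matrixP => i j; rewrite !mxE Defs.metric_sym. Qed.

(** A nonzero vector in the kernel would have length zero. *)
Lemma gram_unit x : gram x \in unitmx.
Proof.
rewrite -row_free_unit -kermx_eq0; apply/rowV0P => v /sub_kermxP vg.
apply/eqP; apply: contraT => v0.
have := metric_pos g (v0 : (v : tangent x) != 0).
by rewrite metric_gramE vg mul0mx mxE ltxx.
Qed.

Lemma cometricT x : (cometric g x)^T = cometric g x.
Proof. by rewrite /cometric trmx_inv -/(gram x) gramT. Qed.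

Definition drow u x : 'rV[R]_n := \row_i dreal u (basis_vec x i).

(** The Riemannian gradient, that is, [du] turned into a tangent vector by the metric. This is the
    form in which [cliff] accepts a differential. *)
Definition rgrad u x : tangent x := drow u x *m cometric g x.

Lemma rgradE u x :
  rgrad u x = \sum_i (\sum_j cometric g x i j * dreal u (basis_vec x j)) *: basis_vec x i.
Proof.
rewrite [LHS]tangent_basisE; apply: eq_bigr => i _; congr (_ *: _).
rewrite mxE; apply: eq_bigr => j _.
by rewrite -[in RHS]cometricT !mxE mulrC.
Qed.

Lemma metric_rgrad u x : metric g (rgrad u x) (rgrad u x) =
  \sum_i \sum_j cometric g x i j *
    (dreal u (basis_vec x i) * dreal u (basis_vec x j)).
Proof.
rewrite metric_gramE /rgrad -!mulmxA (mulmxA (cometric _ _)) mulVmx ?gram_unit//.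
rewrite mul1mx trmx_mul cometricT !mxE; apply: eq_bigr => i _.
rewrite !mxE mulr_sumr; apply: eq_bigr => j _.
by rewrite !mxE mulrCA.
Qed.

Lemma metric_ge0 x (v : tangent x) : 0 <= metric g v v.
Proof.
by have [->|/(metric_pos g)/ltW//] := eqVneq v 0; rewrite metric0l.
Qed.

(** The radicand in [dnorm] is a sum of two squared gradient lengths, hence nonnegative, so squaring
    does undo [Num.sqrt]. *)
Lemma dnorm_sqr (f : M -> R[i]) x : dnorm g f x ^+ 2 =
  metric g (rgrad (fun y => complex.Re (f y)) x) (rgrad (fun y => complex.Re (f y)) x) +
  metric g (rgrad (fun y => complex.Im (f y)) x) (rgrad (fun y => complex.Im (f y)) x).
Proof.
rewrite /dnorm (_ : \sum_i _ = metric g (rgrad (fun y => complex.Re (f y)) x)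
    (rgrad (fun y => complex.Re (f y)) x) +
  metric g (rgrad (fun y => complex.Im (f y)) x)
    (rgrad (fun y => complex.Im (f y)) x)).
  by rewrite sqr_sqrtr// addr_ge0// metric_ge0.
rewrite !metric_rgrad -big_split; apply: eq_bigr => i _.
by rewrite -big_split; apply: eq_bigr => j _; rewrite mulrDr.
Qed.

Lemma rgrad_cst (a : R) x : rgrad (fun=> a) x = 0.
Proof.
rewrite /rgrad (_ : drow _ _ = 0) ?mul0mx//; apply/rowP => i; rewrite !mxE.
exact: (derive_cst a).
Qed.

End Gradient.

(** * Change from the preferred chart at a point to a fixed chart *)

Lemma derive_comp (R : realType) (U V W : normedModType R) (f : U -> V)
    (g : V -> W) x v : differentiable f x -> differentiable g (f x) ->
  'D_v (g \o f) x = 'D_('D_v f x) g (f x).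
Proof.
move=> df dg; rewrite (deriveE _ (differentiable_comp df dg)) diff_comp//.
by rewrite (deriveE _ df) (deriveE _ dg).
Qed.

Lemma derive_lincomb (R : realType) (V W : normedModType R) (I : Type)
    (s : seq I) (a : I -> R) (v : I -> V) (g : V -> W) x : differentiable g x ->
  'D_(\sum_(i <- s) a i *: v i) g x = \sum_(i <- s) a i *: 'D_(v i) g x.
Proof.
move=> dg; rewrite (deriveE _ dg) linear_sum; apply: eq_bigr => i _.
by rewrite linearZ (deriveE _ dg).
Qed.

Section Coordinates.
Context {R : realType} {n : nat} {M : manifoldType R n} (g : riemannian M).

Lemma atlas_chart_at (x : M) : atlas (chart_at x) /\ chart_dom (chart_at x) x.
Proof. exact: (svalP (cid (@atlas_cover R n M x))). Qed.

Section AtPoint.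
Variables (c : chart R n M) (x : M).
Hypotheses (Ac : atlas c) (cx : chart_dom c x).
Let d := chart_at x.
Let Ad : atlas d. Proof. exact: (atlas_chart_at x).1. Qed.
Let dx : chart_dom d x. Proof. exact: (atlas_chart_at x).2. Qed.

Lemma transition_differentiable (a b : chart R n M) : atlas a -> atlas b ->
  chart_dom a x -> chart_dom b x ->
  differentiable (b \o chart_inv a) (a x).
Proof.
move=> Aa Ab ax bx; have [+ _] := @atlas_compat R n M a b Aa Ab 1.
by apply; have [_ /(_ x ax)[aI aK] _ _ _] := @atlas_chart R n M _ Aa; split => //=; rewrite aK.
Qed.

(** Charts are total functions with arbitrary values off their domains, so the cancellation holds
    only near [a x], where the inverse chart lands in the domain of [b]. *)
Lemma near_chart_inv (a b : chart R n M) : atlas a -> atlas b ->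
  chart_dom a x -> chart_dom b x ->
  \forall w \near a x, chart_inv b (b (chart_inv a w)) = chart_inv a w.
Proof.
move=> Aa Ab ax bx.
have [[_ _] aK _ _ _] := @atlas_chart R n M _ Aa.
have [[ob _] bK _ _ _] := @atlas_chart R n M _ Ab.
have : nbhs (a x) (chart_img a `&` chart_inv a @^-1` chart_dom b).
  apply: open_nbhs_nbhs; split; first exact: atlas_good.
  by have [? ?] := aK _ ax; split => //=; rewrite (aK _ ax).2.
by apply: filterS => w [_ /= bw]; exact: (bK _ bw).2.
Qed.

(** [coord_vec] is by definition the derivative of the transition map, so this is the chain rule
    through that map. *)
Lemma dreal_coord (W : normedModType R) (u : M -> W) i :
  differentiable (u \o chart_inv d) (d x) ->
  dreal u (coord_vec c i x) = 'D_(delta_mx 0 i) (u \o chart_inv c) (c x).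
Proof.
move=> du; have dt := transition_differentiable Ac Ad cx dx.
have cK : chart_inv c (c x) = x by have [_ /(_ x cx)[]] := @atlas_chart R n M _ Ac.
have tx : (d \o chart_inv c) (c x) = d x by rewrite /= cK.
have -> : 'D_(delta_mx 0 i) (u \o chart_inv c) (c x) =
    'D_(delta_mx 0 i) ((u \o chart_inv d) \o (d \o chart_inv c)) (c x).
  apply: near_eq_derive; have := near_chart_inv Ac Ad cx dx.
  by apply: filterS => w /= ->.
rewrite derive_comp; [|exact: dt|by rewrite tx].
by rewrite /dreal /coord_vec tx.
Qed.

Lemma dreal_sum (W : normedModType R) (u : M -> W) (v : tangent x) :
  differentiable (u \o chart_inv d) (d x) ->
  dreal u v = \sum_i (v : 'rV[R]_n) 0 i *: dreal u (basis_vec x i).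
Proof.
by move=> du; rewrite /dreal [in LHS](tangent_basisE v) derive_lincomb.
Qed.

(** The transposed Jacobian of the transition from [c] to the preferred chart at [x]. *)
Definition frame_mx : 'M[R]_n := \matrix_i coord_vec c i x.

Lemma coord_gramE :
  \matrix_(i, j) metric g (coord_vec c i x) (coord_vec c j x) =
  frame_mx *m (gram g x *m frame_mx^T).
Proof.
apply/matrixP => i j; rewrite mxE metric_gramE mulmxA.
by rewrite !mxE; apply: eq_bigr => p _; rewrite !mxE; congr (_ * _);
  apply: eq_bigr => q _; rewrite !mxE.
Qed.

(** The inverse is the transposed Jacobian [K] of the reverse transition: by the chain rule, the
    rows of the product are derivatives of a composite equal to the identity near [d x]. *)
Lemma frame_mx_unit : frame_mx \in unitmx.
Proof.
pose K := \matrix_(j < n) 'D_(delta_mx 0 j) (c \o chart_inv d) (d x).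
suff /mulmx1_unit[] : K *m frame_mx = 1%:M by [].
apply/row_matrixP => j; rewrite row_mul row1.
have dt := transition_differentiable Ac Ad cx dx.
have dt' := transition_differentiable Ad Ac dx cx.
have dK : chart_inv d (d x) = x by have [_ /(_ x dx)[]] := @atlas_chart R n M _ Ad.
have tx : (c \o chart_inv d) (d x) = c x by rewrite /= dK.
transitivity ('D_(\sum_i K j i *: delta_mx 0 i) (d \o chart_inv c) (c x)).
  rewrite derive_lincomb// mulmx_sum_row; apply: eq_bigr => i _.
  by rewrite !rowK [in RHS]mxE.
have -> : \sum_i K j i *: delta_mx 0 i = row j K.
  by rewrite [RHS]row_sum_delta; apply: eq_bigr => i _; rewrite !mxE.
rewrite rowK -tx -derive_comp ?tx//.
transitivity ('D_(delta_mx 0 j) (id : 'rV[R]_n -> _) (d x)); last first.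
  exact: derive_id.
apply: near_eq_derive.
have [[od od'] dK1 dK2 _ _] := @atlas_chart R n M _ Ad.
have [[oc _] cK _ _ _] := @atlas_chart R n M _ Ac.
have : nbhs (d x) (chart_img d `&` chart_inv d @^-1` chart_dom c).
  apply: open_nbhs_nbhs; split; first exact: atlas_good.
  by have [? ?] := dK1 _ dx; split => //=; rewrite dK.
by apply: filterS => w [/= wd cw]; rewrite (cK _ cw).2 (dK2 _ wd).2.
Qed.

(* The preferred chart jumps from point to point, so that [basis_vec] is not
   continuous; the coordinate frame of a fixed chart is. *)
Lemma rgrad_coord (u : M -> R) : differentiable (u \o chart_inv d) (d x) ->
  rgrad g u x = \sum_i ((\row_j 'D_(delta_mx 0 j) (u \o chart_inv c) (c x)) *m
    invmx (\matrix_(i, j) metric g (coord_vec c i x) (coord_vec c j x))) 0 i *: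
      coord_vec c i x.
Proof.
move=> du; have JU := frame_mx_unit.
have -> : \row_j 'D_(delta_mx 0 j) (u \o chart_inv c) (c x) =
    drow u x *m frame_mx^T.
  apply/rowP => j; rewrite !mxE -dreal_coord// dreal_sum//.
  by apply: eq_bigr => i _; rewrite !mxE mulrC.
rewrite coord_gramE.
set w := _ *m invmx _.
have -> : \sum_i w 0 i *: coord_vec c i x = w *m frame_mx.
  by rewrite mulmx_sum_row; apply: eq_bigr => i _; rewrite rowK.
have GJU : gram g x *m frame_mx^T \in unitmx.
  by rewrite unitmx_mul gram_unit unitmx_tr.
(* Multiplying by this invertible matrix cancels the inverse Gram matrix on either side and leaves
   [drow u x *m frame_mx^T] on both. *)
apply: (can_inj (mulmxK GJU)).
have -> : rgrad g u x *m (gram g x *m frame_mx^T) = drow u x *m frame_mx^T.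
  by rewrite mulmxA (mulmxKV (gram_unit g x)).
have JGU : frame_mx *m (gram g x *m frame_mx^T) \in unitmx.
  by rewrite unitmx_mul JU.
by rewrite /w -[RHS]mulmxA (mulmxKV JGU).
Qed.

End AtPoint.

Lemma coord_gram_unit (c : chart R n M) x : atlas c -> chart_dom c x ->
  \matrix_(i, j) metric g (coord_vec c i x) (coord_vec c j x) \in unitmx.
Proof.
move=> Ac cx; have JU := frame_mx_unit Ac cx.
by rewrite coord_gramE !unitmx_mul JU gram_unit unitmx_tr.
Qed.

End Coordinates.

(** * Functions vanishing at infinity, and the smooth algebra *)

Section CoronaFunctions.
Context {R : realType} {k n : nat} {G : lieGroupType R k} {M : gRiemannian n G}.
Implicit Types f h : M -> R[i].

(** The exceptional cocompact set need not be compact in [M], so the maximum over it is taken on the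
    orbit space. Applied to [dnorm], this bounds the anticommutator globally. *)
Lemma is_C0G_bounded f : is_C0G f -> exists B : R, forall x, `|f x| <= B%:C.
Proof.
move=> [fc fG f0]; have [A [cA fA]] := f0 1 ltr01.
(* [h] descends to the orbit space, where the closure of [A] is compact. *)
pose h (x : M) : R := complex.Re `|f x|.
have hc : continuous h.
  move=> x; apply/cvgrPdist_lt => e e0.
  have e0' : 0 < e%:C :> R[i] by rewrite ltcR.
  have /(@cvgrPdist_lt R[i] R[i]^o)/(_ _ e0') := fc x.
  apply: filterS => t; rewrite /h -raddfB -ltcR; apply: le_lt_trans.
  by apply: le_trans (normc_ge_Re _) _; exact: ler_dist_dist.
have hG (x y : M) : orbit_rel x y -> h x = h y.
  by move=> /asboolP[g <-]; rewrite /h fG.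
(* [repr] picks orbit representatives with no continuity; the composite is continuous because [h] is
   constant on orbits. *)
have hrc : continuous (h \o repr : orbit_space M -> R).
  apply: repr_comp_continuous => // x y /eqP /eqmodP xy.
  by rewrite (hG _ _ xy).
have hK (x : M) : h (repr (orbit_proj x)) = h x.
  apply: hG; apply/eqmodP; exact: reprK.
set S := closure (@orbit_proj R k n G M @` A) in cA.
have [B hB] : exists B, forall q, S q -> (h \o repr) q <= B.
  have [S0|] := pselect (S !=set0).
    have hw : {within S, continuous (h \o repr)} by exact: continuous_subspaceT.
    have [c _ hc'] := compact_EVT_max S0 cA hw.
    by exists ((h \o repr) c) => q Sq; apply: hc'; rewrite inE.
  by move=> S0; exists 0 => q Sq; exfalso; apply: S0; exists q.
exists (Num.max B 1) => x; rewrite normcR lecR le_max.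
have [Ax|nAx] := pselect (A x).
  rewrite -/(h x) -hK hB//; apply: subset_closure; exact: imageP.
by rewrite [X in _ || X]ltW ?orbT// -ltcR -normcR; exact: fA.
Qed.

(** Serves to make the estimates on all matrix entries hold off one common cocompact set. *)
Lemma cocompact_finite_union (I : finType) (P : I -> M -> Prop) :
  (forall i, exists A : set M, cocompact A /\ forall x, ~ A x -> P i x) ->
  exists A : set M, cocompact A /\ forall x, ~ A x -> forall i, P i x.
Proof.
move=> HP.
suff [A [cA HA]] : exists A : set M,
    cocompact A /\ forall x, ~ A x -> forall i, i \in enum I -> P i x.
  by exists A; split => // x Ax i; apply: HA => //; rewrite mem_enum.
elim: (enum I) => [|i s [A [cA HA]]]; first by exists set0; split => //; exact: cocompact0.
have [B [cB HB]] := HP i.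
exists (B `|` A); split; first exact: cocompactU.
move=> x /not_orP[Bx Ax] j; rewrite inE => /orP[/eqP->|js]; first exact: HB.
exact: HA.
Qed.

Lemma CkM_diffC f x : CkM 1 f ->
  diffC (f \o chart_inv (chart_at x)) (chart_at x x).
Proof. by move=> fC; apply: CkC_on_diffC fC _. Qed.

Lemma CkM_conj r f : CkM r f -> CkM r (fun x => (f x)^*).
Proof.
move=> [f1 f2]; split => c Ac; have oA := atlas_good Ac openT.
  exact: (CkC_conj oA (conj (f1 c Ac) (f2 c Ac))).1.
exact: (CkC_conj oA (conj (f1 c Ac) (f2 c Ac))).2.
Qed.

Lemma dreal_Re_conj f x (v : tangent x) :
  dreal (fun y => complex.Re (f y)^*) v = dreal (fun y => complex.Re (f y)) v :> R.
Proof. by rewrite /dreal; congr ('D_ _ _ _); apply/funext => y; rewrite /= Re_conj. Qed.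

Lemma dreal_Im_conj f x (v : tangent x) : CkM 1 f ->
  dreal (fun y => complex.Im (f y)^*) v = - dreal (fun y => complex.Im (f y)) v :> R.
Proof.
move=> fC; rewrite /dreal -deriveN.
  by congr ('D_ _ _ _); apply/funext => y; rewrite /= Im_conj.
by apply: diff_derivable; exact: (CkM_diffC x fC).2.
Qed.

Lemma dnorm_conj f x : CkM 1 f ->
  dnorm (gmetric M) (fun y => (f y)^*) x = dnorm (gmetric M) f x.
Proof.
move=> fC.
rewrite /dnorm; congr Num.sqrt; apply: eq_bigr => i _; apply: eq_bigr => j _.
by rewrite !dreal_Im_conj// !dreal_Re_conj mulrNN.
Qed.

(** Needed for the upper right block, whose entries are conjugates of entries of [U]. *)
Lemma is_CginfG_conj f : is_CginfG f -> is_CginfG (fun x => (f x)^*).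
Proof.
move=> [fb fC fd]; split.
- have fP : f \in @CbG_pred R k n G M by apply/asboolP.
  by have /asboolP := CbG_conj_subproof (MkCbG fP).
- by move=> r; exact: CkM_conj.
- rewrite (_ : (fun x => _) = fun x => (dnorm (gmetric M) f x)%:C)//.
  by apply/funext => x; rewrite dnorm_conj.
Qed.

Lemma is_C0G0 : is_C0G (fun=> 0 : R[i]) (M := M).
Proof.
split; [exact: cst_continuous | by [] |].
move=> e e0; exists set0; split; first exact: cocompact0.
by move=> x _; rewrite normr0 ltcR.
Qed.

Lemma is_CginfG0 : is_CginfG (fun=> 0 : R[i]) (M := M).
Proof.
split.
- by case: is_C0G0 => ? ? _; split => //; exists 0 => x; rewrite normr0.
- by move=> r; exact: CkC_on_cst.
- rewrite (_ : (fun x => _) = fun=> 0); first exact: is_C0G0.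
  apply/funext => x; rewrite (_ : dnorm _ _ _ = 0)//; apply/eqP; rewrite -sqrf_eq0 dnorm_sqr.
  by rewrite !rgrad_cst metric0l addr0.
Qed.

End CoronaFunctions.

(** * From unitarity in the quotient to smallness at infinity *)

Section UnitaryLift.
Context {R : realType} {k n : nat} {G : lieGroupType R k} {M : gRiemannian n G}.

Lemma CbG_sumE (I : Type) (s : seq I) (F : I -> CbG M) x :
  (\sum_(i <- s) F i : CbG M) x = \sum_(i <- s) F i x.
Proof. by apply: (big_morph (fun f : CbG M => f x)). Qed.

Lemma corona_pi0 : corona_pi (0 : CbG M) = 0.
Proof.
have := corona_piD (0 : CbG M) 0; rewrite addr0 => /esym/eqP.
by rewrite -subr_eq0 addrK => /eqP.
Qed.

Lemma corona_pi_sum (I : Type) (s : seq I) (F : I -> CbG M) :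
  corona_pi (\sum_(i <- s) F i) = \sum_(i <- s) corona_pi (F i).
Proof.
apply: (big_morph (@corona_pi R k n G M)); first exact: corona_piD.
exact: corona_pi0.
Qed.

Lemma corona_pi_mulmx l (U V : 'M[CbG M]_l) :
  map_mx (@corona_pi R k n G M) (U *m V) =
  map_mx (@corona_pi R k n G M) U *m map_mx (@corona_pi R k n G M) V.
Proof.
apply/matrixP => i j; rewrite !mxE corona_pi_sum.
by apply: eq_bigr => p _; rewrite !mxE corona_piM.
Qed.

(** Equality in the quotient means that the difference of the lifts lies in the ideal [C0G]; this
    turns an algebraic identity into a decay estimate. *)
Lemma corona_pi_eq1 l (W : 'M[CbG M]_l) :
  map_mx (@corona_pi R k n G M) W = 1%:M ->
  forall i j, is_C0G (fun x => W i j x - (i == j)%:R).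
Proof.
move=> W1 i j; have /eqP : corona_pi (W i j) = corona_pi ((i == j)%:R).
  have := congr1 (fun A : 'M[CbG_mod_C0G M]_l => A i j) W1; rewrite !mxE => ->.
  case: (i == j); first by rewrite corona_pi1.
  by rewrite corona_pi0.
rewrite corona_piE => /asboolP; congr is_C0G.
by apply/funext => x; case: (i == j).
Qed.

Section OffDiag.
Variables (l : nat) (U : 'M[CbG M]_l).

(** The matrix inside [corona_endo], separated from the grading so that its entries are scalar
    functions on [M]. *)
Definition corona_mx (x : M) : 'M[R[i]]_(l + l) :=
  let Ux : 'M[R[i]]_l := \matrix_(i, j) U i j x in
  block_mx 0 (map_mx Num.conj Ux)^T Ux 0.

Lemma corona_mx_herm x i j : corona_mx x i j = (corona_mx x j i)^*.
Proof.
rewrite /corona_mx.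
by case: (split_ordP i) => i' ->; case: (split_ordP j) => j' ->;
  rewrite ?block_mxEul ?block_mxEur ?block_mxEdl ?block_mxEdr !mxE ?rmorph0// conjCK.
Qed.

Lemma corona_mx_smooth : (forall i j, is_CginfG (U i j)) ->
  forall i j, is_CginfG (fun x => corona_mx x i j).
Proof.
move=> US i j.
case: (split_ordP i) => i' ->; case: (split_ordP j) => j' ->.
- rewrite (_ : (fun x => _) = fun=> 0); first exact: is_CginfG0.
  by apply/funext => x; rewrite block_mxEul mxE.
- rewrite (_ : (fun x => _) = fun x => (U j' i' x)^*); first exact: is_CginfG_conj.
  by apply/funext => x; rewrite block_mxEur !mxE.
- rewrite (_ : (fun x => _) = U i' j'); first exact: US.
  by apply/funext => x; rewrite block_mxEdl !mxE.
- rewrite (_ : (fun x => _) = fun=> 0); first exact: is_CginfG0.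
  by apply/funext => x; rewrite block_mxEdr mxE.
Qed.

(** The square is block diagonal with blocks [U^* U] and [U U^*], so each of the two unitarity
    equations settles one block. *)
Lemma corona_mx_sqr : unitary_mx (map_mx (@corona_pi R k n G M) U) ->
  forall i j, is_C0G (fun x => (corona_mx x *m corona_mx x) i j - (i == j)%:R).
Proof.
move=> [UUs UsU].
have E : map_mx (@corona_conj R k n G M) (map_mx (@corona_pi R k n G M) U) =
    map_mx (@corona_pi R k n G M) (map_mx (@CbG_conj R k n G M) U).
  by apply/matrixP => i j; rewrite !mxE corona_pi_conj.
(* Since [corona_pi] commutes with products and conjugation, both equations now concern images of
   matrix products of lifts. *)
rewrite E !map_trmx -!corona_pi_mulmx in UUs UsU.
have UUs0 := corona_pi_eq1 UUs; have UsU0 := corona_pi_eq1 UsU.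
move=> i j; rewrite /corona_mx.
under [X in is_C0G X]eq_fun do rewrite mulmx_block !mul0mx !mulmx0 !addr0 !add0r.
case: (split_ordP i) => i' ->; case: (split_ordP j) => j' ->.
- move: (UsU0 i' j'); congr is_C0G; apply/funext => x.
  rewrite block_mxEul (inj_eq (@lshift_inj _ _)) !mxE CbG_sumE; congr (_ - _).
  by apply: eq_bigr => p _; rewrite !mxE.
- rewrite eq_lrshift; rewrite (_ : (fun x => _) = fun=> 0); last first.
    by apply/funext => x; rewrite block_mxEur !mxE subrr.
  exact: is_C0G0.
- rewrite eq_rlshift; rewrite (_ : (fun x => _) = fun=> 0); last first.
    by apply/funext => x; rewrite block_mxEdl !mxE subrr.
  exact: is_C0G0.
- move: (UUs0 i' j'); congr is_C0G; apply/funext => x.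
  rewrite block_mxEdr (inj_eq (@rshift_inj _ _)) !mxE CbG_sumE; congr (_ - _).
  by apply: eq_bigr => p _; rewrite !mxE.
Qed.

End OffDiag.
End UnitaryLift.

(** * Norm estimates in the fibers *)

Section HermitianFibers.
Context {R : realType} {k n : nat} {G : lieGroupType R k} {M : gRiemannian n G}.
Variable E : gCliffordBundle M.
Implicit Types (x : M) (f : M -> R[i]).

Let Ehm : is_hermitian E. Proof. by case: (gcb_axioms E) => _ []. Qed.

Lemma herm_conj x (v w : E x) : herm v w = (herm w v)^*.
Proof. by case: Ehm. Qed.

Lemma herm_linl x (w : E x) : linear (fun v : E x => herm v w : R[i]^o).
Proof. by move=> a u v; case: Ehm => + _ _ _; apply. Qed.

Lemma hermZl x a (v w : E x) : herm (a *: v) w = a * herm v w.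
Proof. exact: (linZ (herm_linl w)). Qed.

Lemma hermDl x (u v w : E x) : herm (u + v) w = herm u w + herm v w.
Proof. exact: (linD (herm_linl w)). Qed.

Lemma herm_suml x (I : Type) (s : seq I) (F : I -> E x) w :
  herm (\sum_(i <- s) F i) w = \sum_(i <- s) herm (F i) w.
Proof. exact: (lin_sum (herm_linl w)). Qed.

Lemma hermZr x a (v w : E x) : herm w (a *: v) = a^* * herm w v.
Proof. by rewrite herm_conj hermZl rmorphM /= -herm_conj. Qed.

Lemma hermNr x (v w : E x) : herm w (- v) = - herm w v.
Proof. by rewrite -scaleN1r hermZr rmorphN rmorph1 mulN1r. Qed.

Lemma hermDr x (u v w : E x) : herm w (u + v) = herm w u + herm w v.
Proof. by rewrite herm_conj hermDl rmorphD /= -!herm_conj. Qed.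

Lemma herm_sumr x (I : Type) (s : seq I) (F : I -> E x) w :
  herm w (\sum_(i <- s) F i) = \sum_(i <- s) herm w (F i).
Proof.
rewrite herm_conj herm_suml rmorph_sum; apply: eq_bigr => i _.
by rewrite [RHS]herm_conj.
Qed.

(** The squared norm as a real number, so that estimates take place in the ordered field [R] and not
    in the partial order of [R[i]]. *)
Definition hnorm2 x (v : E x) : R := complex.Re (herm v v).

Lemma hnorm2_ge0 x (v : E x) : 0 <= hnorm2 v.
Proof.
rewrite /hnorm2; have [->|v0] := eqVneq v 0; first by rewrite (lin0 (herm_linl _)).
by have [_ _ /(_ x v v0) + _] := Ehm; rewrite ltcE => /andP[_ /ltW].
Qed.

(** Conjugate symmetry makes the imaginary part equal to its own opposite. *)
Lemma hermvvE x (v : E x) : herm v v = (hnorm2 v)%:C.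
Proof.
apply/eqP; rewrite eq_complex /= eqxx /=; apply/eqP.
have := congr1 (@complex.Im R) (herm_conj v v); rewrite Im_conj.
by set t := complex.Im _ => tt; have : t + t = 0; [rewrite {1}tt addNr|lra].
Qed.

Lemma Re_herm_sym x (u v : E x) : complex.Re (herm u v) = complex.Re (herm v u).
Proof. by rewrite herm_conj Re_conj. Qed.

Lemma hnorm2D x (u v : E x) :
  hnorm2 (u + v) = hnorm2 u + hnorm2 v + 2 * complex.Re (herm u v).
Proof.
rewrite /hnorm2 hermDl !hermDr !raddfD /= (Re_herm_sym v u).
lra.
Qed.

Lemma hnorm2Z x a (v : E x) : hnorm2 (a *: v) = complex.Re (`|a| ^+ 2) * hnorm2 v.
Proof.
rewrite /hnorm2 hermZl hermZr mulrA -normCK hermvvE.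
have : complex.Im (`|a| ^+ 2) = 0.
  by apply: ger0_Im; rewrite exprn_ge0.
by case: (_ ^+ _) => p q /= ->; rewrite mulr0 subr0.
Qed.

(** By the parallelogram law, the two sides differ by the squared norm of [u - v]. *)
Lemma hnorm2D_le x (u v : E x) : hnorm2 (u + v) <= 2 * hnorm2 u + 2 * hnorm2 v.
Proof.
have := hnorm2_ge0 (u + (- 1) *: v).
rewrite !hnorm2D hnorm2Z hermZr normrN1 expr1n rmorphN rmorph1 mulN1r raddfN /=.
lra.
Qed.

Lemma hnorm20 x : hnorm2 (0 : E x) = 0.
Proof. by rewrite /hnorm2 (lin0 (herm_linl _)). Qed.

(** The factor doubles with each summand. This is crude, but for boundedness any constant depending
    only on the length will do. *)
Lemma hnorm2_sum_le x (I : Type) (s : seq I) (v : I -> E x) :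
  hnorm2 (\sum_(i <- s) v i) <= 2 ^+ size s * \sum_(i <- s) hnorm2 (v i).
Proof.
elim: s => [|i s IH]; first by rewrite !big_nil hnorm20 mulr0.
rewrite !big_cons; apply: le_trans (hnorm2D_le _ _) _.
have S0 : 0 <= \sum_(j <- s) hnorm2 (v j) by apply: sumr_ge0 => j _; exact: hnorm2_ge0.
have p1 : 1 <= 2 ^+ size s :> R by rewrite exprn_ege1// ler1n.
have h0 := hnorm2_ge0 (v i).
rewrite exprS -mulrA -mulrDr ler_pM2l// mulrDr lerD//.
by rewrite ler_peMl.
Qed.

(* The Cauchy-Schwarz inequality in weighted arithmetic-geometric form, from the
   positivity of [hnorm2 (a + d *: b)]. *)
Lemma Re_herm_ge x (a b : E x) (d N : R) : 0 < d -> hnorm2 a <= 2 * d ^+ 2 * N ->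
  - (d * (N + hnorm2 b)) <= complex.Re (herm a b).
Proof.
move=> d0 aN; have := hnorm2_ge0 (a + d%:C *: b).
have dNb : 0 <= d * hnorm2 b by rewrite mulr_ge0 ?hnorm2_ge0// ltW.
have nd : `|d%:C| = d%:C :> R[i] by rewrite ger0_norm// ler0c ltW.
rewrite hnorm2D hnorm2Z hermZr conjC_real nd.
rewrite (_ : complex.Re (d%:C ^+ 2) = d * d) ?expr2 /= ?mulr0 ?subr0//.
case: (herm a b) => p q /=; rewrite mul0r subr0 => H.
(* Division by [d] gives the bound with [hnorm2 b / 2], weakened to [hnorm2 b] by [dNb]. The 2 in
   the hypothesis on [a] is the one in [hnorm2_cliff_d]. *)
suff : 0 <= d * (2 * (d * N) + d * hnorm2 b + 2 * p) by rewrite pmulr_rge0//; lra.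
by rewrite expr2 in aN H; lra.
Qed.

End HermitianFibers.

(** * Clifford multiplication by differentials, and the Leibniz rule for the Dirac operator *)

Section CliffordFibers.
Context {R : realType} {k n : nat} {G : lieGroupType R k} {M : gRiemannian n G}.
Variable E : gCliffordBundle M.
Implicit Types (x : M) (f : M -> R[i]).

Let Evb : is_vector_bundle E. Proof. by case: (gcb_axioms E). Qed.
Let Egr : is_grading E. Proof. by case: (gcb_axioms E) => _ []. Qed.
Let Ecl : is_clifford_mult E. Proof. by case: (gcb_axioms E). Qed.
Let Ecn : is_clifford_connection E. Proof. by case: (gcb_axioms E). Qed.

Lemma grading_lin x : linear (@grading _ _ _ _ _ E x).
Proof. by case: Egr. Qed.

Lemma cliff_lin x (v : tangent x) : linear (cliff v : E x -> E x).
Proof. by case: Ecl. Qed.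

Lemma cliffN x (v : tangent x) (e : E x) : cliff (- v) e = - cliff v e.
Proof.
have [_ cl _ _ _] := Ecl.
have c0 : cliff (0 : tangent x) e = 0.
  have := cl x 1 0 0 e; rewrite !scale1r addr0 => /esym/eqP.
  by rewrite -subr_eq0 addrK => /eqP.
have := cl x (- 1) v 0 e.
by rewrite !addr0 c0 addr0 rmorphN rmorph1 !scaleN1r.
Qed.

Lemma cliff_suml x (I : Type) (s : seq I) (a : I -> R) (v : I -> tangent x)
    (e : E x) :
  cliff (\sum_(i <- s) a i *: v i) e = \sum_(i <- s) (a i)%:C *: cliff (v i) e.
Proof.
have [_ cl _ _ _] := Ecl.
elim: s => [|i s IH]; last by rewrite !big_cons cl IH.
rewrite !big_nil; have := cl x 1 0 0 e; rewrite !scale1r addr0 => /esym/eqP.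
by rewrite -subr_eq0 addrK => /eqP.
Qed.

(** Skew-adjointness and [c(v)^2 = - |v|^2] each contribute a sign, and the two cancel. *)
Lemma hnorm2_cliff x (v : tangent x) (e : E x) :
  hnorm2 (cliff v e) = metric (gmetric M) v v * hnorm2 e.
Proof.
have [_ _ cl2 cl3 _] := Ecl.
rewrite /hnorm2 cl3 cl2 hermZr hermvvE.
rewrite (_ : (- _)^* = - (metric (gmetric M) v v)%:C); last first.
  by rewrite rmorphN/= conjC_real.
by rewrite mulNr opprK /= mulr0 subr0.
Qed.

(** Clifford multiplication by the complex covector [df]: as [cliff] takes real tangent vectors, it
    is extended complex linearly from the gradients of the real and imaginary parts. *)
Definition cliff_d f x (e : E x) : E x :=
  cliff (rgrad (gmetric M) (fun y => complex.Re (f y)) x) e +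
  'i%C *: cliff (rgrad (gmetric M) (fun y => complex.Im (f y)) x) e.

Lemma cliff_d_lin f x : linear (@cliff_d f x).
Proof.
move=> a u v; rewrite /cliff_d !cliff_lin !scalerDr !scalerA (mulrC a).
by rewrite !addrA; congr (_ + _); rewrite -!addrA; congr (_ + _); rewrite addrC.
Qed.

(** The factor 2 is the price of treating the real and imaginary parts separately. *)
Lemma hnorm2_cliff_d f x (e : E x) :
  hnorm2 (cliff_d f e) <= 2 * dnorm (gmetric M) f x ^+ 2 * hnorm2 e.
Proof.
apply: le_trans (hnorm2D_le _ _) _.
rewrite hnorm2Z dnorm_sqr !hnorm2_cliff.
rewrite (_ : complex.Re (`|'i%C| ^+ 2) = 1); last first.
  by rewrite complexiE normCi expr1n.
by rewrite mul1r mulrDr mulrDl !mulrA.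
Qed.

(** Each real part is skew-adjoint; the conjugate of ['i] in the second slot of [herm] is absorbed
    by conjugating [f]. *)
Lemma cliff_d_adj f x (e e' : E x) : CkM 1 f ->
  herm (cliff_d f e) e' = - herm e (cliff_d (fun y => (f y)^*) e').
Proof.
move=> fC; have [_ _ _ cl3 _] := Ecl.
rewrite /cliff_d hermDl hermZl !cl3 hermDr hermZr.
have -> : rgrad (gmetric M) (fun y => complex.Re (f y)^*) x =
    rgrad (gmetric M) (fun y => complex.Re (f y)) x.
  by congr (_ *m _); apply/rowP => i; rewrite !mxE dreal_Re_conj.
have -> : rgrad (gmetric M) (fun y => complex.Im (f y)^*) x =
    - rgrad (gmetric M) (fun y => complex.Im (f y)) x.
  by rewrite -mulNmx; congr (_ *m _); apply/rowP => i; rewrite !mxE dreal_Im_conj.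
rewrite cliffN hermNr complexiE conjCi mulrNN opprD.
by rewrite mulrN.
Qed.

Lemma cliff_d_grading f x (e : E x) :
  cliff_d f (grading e) = - grading (cliff_d f e).
Proof.
have [_ _ _ _ [cl5 _]] := Ecl.
rewrite /cliff_d (linD (@grading_lin x)) (linZ (@grading_lin x)) !cl5.
by rewrite scalerN opprD !opprK.
Qed.

Lemma frame_dom_open F : frames E F -> open (fr_dom F).
Proof. by case: Evb => + _ _ => /[apply] -[]. Qed.

Lemma Ck_sectionZ r f (s : section_of E) : CkM r f -> Ck_section r s ->
  Ck_section r (fun y => f y *: s y).
Proof.
move=> fC sC F FE i; have oF := frame_dom_open FE.
have ag := @atlas_good R n M.
have fF : CkC_on (@atlas R n M) r (fr_dom F) f by apply: CkC_on_sub fC.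
apply: (CkC_on_ext ag oF _ (CkC_onM ag oF fF (sC F FE i))) => y Fy.
by rewrite cooZ.
Qed.

Lemma Ck_sectionD r (s t : section_of E) : Ck_section r s -> Ck_section r t ->
  Ck_section r (fun y => s y + t y).
Proof.
move=> sC tC F FE i; have oF := frame_dom_open FE.
have ag := @atlas_good R n M.
apply: (CkC_on_ext ag oF _ (CkC_onD ag oF (sC F FE i) (tC F FE i))) => y Fy.
by have := coo_lin 1 (s y) (t y) i FE Fy; rewrite scale1r mul1r.
Qed.

Lemma Ck_section0 r : Ck_section r (fun y => 0 : E y).
Proof.
move=> F FE i; have oF := frame_dom_open FE; have ag := @atlas_good R n M.
by apply: (CkC_on_ext ag oF _ (CkC_on_cst _ _ _ 0)) => y Fy; rewrite coo0.
Qed.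

Lemma coo_linear_map F x (T : E x -> E x) (v : E x) i : linear T ->
    frames E F -> fr_dom F x ->
  fr_coo (l := F) i (T v) = \sum_j fr_coo (l := F) j v *
    fr_coo (l := F) i (T (fr_sec (l := F) j x)).
Proof.
move=> Tl FE Fx; have [+ _ _] := Evb => /(_ F FE)[_ /(_ x Fx)[Hv _]].
rewrite [in LHS](Hv v) (lin_sum Tl).
rewrite (big_morph (fun w : E x => fr_coo (l := F) i w) (id1 := 0) (op1 := +%R)).
- by apply: eq_bigr => j _; rewrite (linZ Tl) cooZ.
- by move=> u w; have := coo_lin 1 u w i FE Fx; rewrite scale1r mul1r.
- exact: coo0.
Qed.

Lemma Ck_section_endo r (T : forall x, E x -> E x) (s : section_of E) :
  (forall x, linear (T x)) -> Ck_endo r T -> Ck_section r s ->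
  Ck_section r (fun y => T y (s y)).
Proof.
move=> Tl TC sC F FE i; have oF := frame_dom_open FE.
have ag := @atlas_good R n M.
apply: (CkC_on_ext ag oF _ (CkC_on_sum ag _ oF
  (fun j => CkC_onM ag oF (sC F FE j) (TC F FE i j)))) => y Fy.
by rewrite (coo_linear_map (s y) i (Tl y) FE Fy).
Qed.

Lemma Ck_section_grading r (s : section_of E) : Ck_section r s ->
  Ck_section r (fun y => grading (s y)).
Proof.
by apply: (Ck_section_endo (T := @grading _ _ _ _ _ E)); case: Egr.
Qed.

Lemma Ck_section_sum r (I : Type) (q : seq I) (s : I -> section_of E) :
  (forall i, Ck_section r (s i)) ->
  Ck_section r (fun y => \sum_(i <- q) s i y).
Proof.
move=> sC; elim: q => [|i q IH].
  rewrite (_ : (fun _ => _) = fun y => 0 : E y); first exact: Ck_section0.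
  by apply: functional_extensionality_dep => y; rewrite big_nil.
rewrite (_ : (fun _ => _) = fun y => s i y + \sum_(j <- q) s j y).
  exact: Ck_sectionD.
by apply: functional_extensionality_dep => y; rewrite big_cons.
Qed.

Lemma diracD (s t : section_of E) x : Ck_section 1 s -> Ck_section 1 t ->
  Defs.dirac (fun y => s y + t y) x = Defs.dirac s x + Defs.dirac t x.
Proof.
move=> sC tC; have [[_ nD _ _] _ _ _] := Ecn.
rewrite /Defs.dirac -big_split; apply: eq_bigr => i _.
rewrite -big_split; apply: eq_bigr => j _.
by rewrite nD// (linD (cliff_lin _)) scalerDr.
Qed.

Lemma dirac0 x : Defs.dirac (fun y => 0 : E y) x = 0.
Proof.
have := diracD x (Ck_section0 1) (Ck_section0 1).
rewrite (_ : (fun y => 0 + 0) = fun y => 0 : E y); last first.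
  by apply: functional_extensionality_dep => y; rewrite addr0.
by move=> /esym/eqP; rewrite -subr_eq0 addrK => /eqP.
Qed.

Lemma dirac_sum (I : Type) (q : seq I) (s : I -> section_of E) x :
  (forall i, Ck_section 1 (s i)) ->
  Defs.dirac (fun y => \sum_(i <- q) s i y) x = \sum_(i <- q) Defs.dirac (s i) x.
Proof.
move=> sC; elim: q => [|i q IH].
  rewrite big_nil -[RHS](dirac0 x); congr (Defs.dirac _ x).
  by apply: functional_extensionality_dep => y; rewrite big_nil.
rewrite big_cons -IH -diracD//; last exact: Ck_section_sum.
by congr (Defs.dirac _ x); apply: functional_extensionality_dep => y; rewrite big_cons.
Qed.

Lemma dirac_grading (s : section_of E) x : Ck_section 1 s ->
  Defs.dirac (fun y => grading (s y)) x = - grading (Defs.dirac s x).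
Proof.
move=> sC; have [_ _ ng _] := Ecn; have [_ _ _ _ [cg _]] := Ecl.
rewrite /Defs.dirac (lin_sum (@grading_lin x)) -sumrN; apply: eq_bigr => i _.
rewrite (lin_sum (@grading_lin x)) -sumrN; apply: eq_bigr => j _.
by rewrite ng// (linZ (@grading_lin x)) cg scalerN opprK.
Qed.

(** The commutator identity [[D, f] = c(df)]: the zeroth-order term of the connection, contracted
    with the cometric, reassembles into the gradients. *)
Lemma dirac_leibniz f (s : section_of E) x : CkM 1 f -> Ck_section 1 s ->
  Defs.dirac (fun y => f y *: s y) x = cliff_d f (s x) + f x *: Defs.dirac s x.
Proof.
move=> fC sC; have [[_ _ nZ _] _ _ _] := Ecn.
(* The gradient is spread over the double sum that defines [dirac], so that the identity can be
   compared term by term. *)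
have cdE (u : M -> R) : cliff (rgrad (gmetric M) u x) (s x) =
    \sum_i \sum_j (cometric (gmetric M) x i j * dreal u (basis_vec x j))%:C *:
      cliff (basis_vec x i) (s x).
  rewrite rgradE cliff_suml; apply: eq_bigr => i _.
  by rewrite rmorph_sum scaler_suml.
rewrite /cliff_d !cdE /Defs.dirac !scaler_sumr -!big_split; apply: eq_bigr => i _.
rewrite !scaler_sumr -!big_split; apply: eq_bigr => j _ /=.
rewrite nZ// (linD (cliff_lin _)) !(linZ (cliff_lin _)) scalerDr !scalerA.
rewrite (mulrC (f x)); congr (_ + _); rewrite -scalerDl; congr (_ *: _).
by rewrite /dcomplex; simpc; rewrite /=; simpc.
Qed.

End CliffordFibers.

(** * Regularity of endomorphisms in local frames *)

Section ContinuousEndomorphisms.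
Context {R : realType} {k n : nat} {G : lieGroupType R k} {M : gRiemannian n G}.
Variable E : gCliffordBundle M.
Implicit Types (x : M) (f : M -> R[i]).

Let Ecl : is_clifford_mult E. Proof. by case: (gcb_axioms E). Qed.

Lemma coo_linear F x i : frames E F -> fr_dom F x ->
  linear (fun v : E x => fr_coo (l := F) i v : R[i]^o).
Proof. by move=> FE Fx a v w; exact: coo_lin. Qed.

(** By [rgrad_coord], the entry is a finite sum of products of three kinds of continuous functions
    on the chart: partial derivatives of [u], entries of the inverse Gram matrix of the coordinate
    frame, and entries of Clifford multiplication by coordinate fields. *)
Lemma C0_cliff_rgrad (u : M -> R) c F i j : atlas c -> frames E F ->
  Ck_on (@atlas R n M) 1 setT u ->
  CkC 0 (chart_img c `&` chart_inv c @^-1` fr_dom F)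
    ((fun x => fr_coo (l := F) i
       (cliff (rgrad (gmetric M) u x) (fr_sec (l := F) j x))) \o chart_inv c).
Proof.
move=> Ac FE uC; have [_ _ _ _ [_ cl6]] := Ecl.
have [[_ oI] _ Ic _ _] := @atlas_chart R n M _ Ac.
set D := _ `&` _; have oD : open D.
  by apply: (@atlas_good R n M) => //; exact: frame_dom_open FE.
pose Q w : 'M[R]_n := \matrix_(p, q) metric (gmetric M)
  (coord_vec c p (chart_inv c w)) (coord_vec c q (chart_inv c w)).
have QC p q : Ck 0 D (fun w => invmx (Q w) p q : R).
  apply: C0_invmx => // [w [Iw _]|a b].
    exact: coord_gram_unit Ac (Ic w Iw).1.
  rewrite (_ : (fun w => _) = (fun x => metric (gmetric M) (coord_vec c a x)
    (coord_vec c b x) : R) \o chart_inv c); last by apply/funext => w; rewrite mxE.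
  apply: Ck_sub (metric_smooth (gmetric M) Ac a b 0 Ac).
  by move=> w [Iw _]; split => //; exact: (Ic w Iw).1.
(* The components of the gradient in the coordinate frame of [c]. *)
pose co p w := \sum_q 'D_(delta_mx 0 q) (u \o chart_inv c) w * invmx (Q w) q p.
have coC p : Ck 0 D (co p : _ -> R).
  apply: Ck_sum => // q; apply: Ck_mul => //.
  by apply: (@Ck_sub _ _ _ 0 (chart_img c `&` chart_inv c @^-1` setT));
    [move=> v []|exact: (uC c Ac).2].
have clC p : CkC 0 D ((fun x => fr_coo (l := F) i
    (cliff (coord_vec c p x) (fr_sec (l := F) j x))) \o chart_inv c).
  have /CkC_onP/(_ c Ac) := cl6 c p Ac F FE i j 0; apply: CkC_sub.
  by move=> w [Iw Fw]; split => //; split => //; exact: (Ic w Iw).1.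
apply: (CkC_ext oD _ (CkC_sum (index_enum _) oD (fun p =>
  CkC_mul oD (CkC_real (coC p)) (clC p)))) => w [Iw /= Fw].
have [cw wK] := Ic w Iw.
rewrite (@rgrad_coord _ _ _ (gmetric M) c (chart_inv c w) Ac cw); last first.
  have [Ad dx] := atlas_chart_at (chart_inv c w).
  apply: (uC _ Ad).1; split => //.
  by have [_ /(_ _ dx)[]] := @atlas_chart R n M _ Ad.
rewrite cliff_suml (lin_sum (coo_linear i FE Fw)); apply: eq_bigr => p _.
rewrite (linZ (coo_linear i FE Fw)) wK; congr (_%:C * _).
by rewrite mxE; apply: eq_bigr => q _; rewrite mxE.
Qed.

Lemma C0_endo_cliff_d f : CkM 1 f -> Ck_endo 0 (fun x => @cliff_d _ _ _ _ _ E f x).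
Proof.
move=> [f1 f2] F FE i j; apply/CkC_onP => c Ac.
have oD : open (chart_img c `&` chart_inv c @^-1` fr_dom F).
  by apply: (@atlas_good R n M) => //; exact: frame_dom_open FE.
apply: (CkC_ext oD _ (CkC_add oD (C0_cliff_rgrad i j Ac FE f1)
  (CkC_mul oD (CkC_cst 0 _ 'i%C) (C0_cliff_rgrad i j Ac FE f2)))) => w [Iw /= Fw].
by rewrite /cliff_d (linD (coo_linear i FE Fw)) (linZ (coo_linear i FE Fw)).
Qed.

Lemma Ck_endo_comp r (S T : forall x, E x -> E x) : (forall x, linear (T x)) ->
  Ck_endo r S -> Ck_endo r T -> Ck_endo r (fun x v => T x (S x v)).
Proof.
move=> Tl SC TC F FE i j; have oF := frame_dom_open FE.
have ag := @atlas_good R n M.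
apply: (CkC_on_ext ag oF _ (CkC_on_sum ag _ oF
  (fun p => CkC_onM ag oF (SC F FE p j) (TC F FE i p)))) => y Fy.
by rewrite (coo_linear_map _ i (Tl y) FE Fy).
Qed.

Lemma Ck_endoZ r f (T : forall x, E x -> E x) : CkM r f -> Ck_endo r T ->
  Ck_endo r (fun x v => f x *: T x v).
Proof.
move=> fC TC F FE i j; have oF := frame_dom_open FE.
have ag := @atlas_good R n M.
have fF : CkC_on (@atlas R n M) r (fr_dom F) f by apply: CkC_on_sub fC.
apply: (CkC_on_ext ag oF _ (CkC_onM ag oF fF (TC F FE i j))) => y Fy.
by rewrite cooZ.
Qed.

Section TwistedEndomorphisms.
Variables (l : nat) (T : 'I_(l + l) -> 'I_(l + l) -> forall x, E x -> E x).
Hypothesis Tl : forall i j x, linear (T i j (x := x)).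

(** A matrix of fiber endomorphisms acting on the twisted bundle. [corona_endo] and its
    anticommutator with the Dirac operator both have this shape, which lets them share linearity and
    regularity. *)
Definition twist_endo x (v : twist E l x) : twist E l x :=
  [ffun i => \sum_j T i j (v j : E x)].

Lemma twist_endo_linear x : linear (@twist_endo x).
Proof.
move=> a u v; apply/ffunP => i; rewrite !ffunE scaler_sumr -big_split.
by apply: eq_bigr => j _; rewrite !ffunE Tl.
Qed.

(** A vector of the twisted frame has a single nonzero component, so each entry in that frame is an
    entry of one [T i j]. *)
Lemma Ck_twist_endo r : (forall i j, Ck_endo r (fun x => @T i j x)) ->
  Ck_endo r twist_endo.
Proof.
move=> TC _ [F FE <-] p q /=; have oF := frame_dom_open FE.
apply: (CkC_on_ext (@atlas_good R n M) oF _
  (TC (enum_val p).2 (enum_val q).2 F FE (enum_val p).1 (enum_val q).1)) => x Fx.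
rewrite ffunE (bigD1 (enum_val q).2)//= ffunE eqxx big1 ?addr0// => j jq.
by rewrite ffunE (negPf jq) (lin0 (@Tl _ _ _)).
Qed.

End TwistedEndomorphisms.

End ContinuousEndomorphisms.

(** * Verification of the admissibility conditions *)

Section CoronaEndomorphism.
Context {R : realType} {k n : nat} {G : lieGroupType R k} {M : gRiemannian n G}.
Variables (E : gCliffordBundle M) (l : nat) (U : 'M[CbG M]_l).
Hypothesis U_smooth : forall i j, is_CginfG (U i j).
Implicit Types (x : M).

Local Notation tw := (twist E l).
Local Notation m := (l + l)%N.
Local Notation b := (corona_mx U).
Local Notation z := (@grading _ _ _ _ _ E _).
Local Notation Phi := (@corona_endo R k n G M E l U).

Let Egr : is_grading E. Proof. by case: (gcb_axioms E) => _ []. Qed.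
Let Eeq : is_equivariant E. Proof. by case: (gcb_axioms E). Qed.

Let bS i j : is_CginfG (fun x => b x i j). Proof. exact: corona_mx_smooth. Qed.
Let bC i j r : CkM r (fun x => b x i j). Proof. by case: (bS i j). Qed.

Lemma corona_endoE x (v : tw x) i :
  (Phi v : {ffun 'I_m -> E x}) i = \sum_j b x i j *: z (v j).
Proof. by rewrite ffunE. Qed.

Lemma twist_hermE x (v w : tw x) :
  herm v w = \sum_i herm (v i : E x) (w i : E x).
Proof. by []. Qed.

Lemma twist_hnorm2E x (v : tw x) : hnorm2 v = \sum_i hnorm2 (v i : E x).
Proof. by rewrite /hnorm2 twist_hermE raddf_sum. Qed.

Let T i j x (e : E x) : E x := b x i j *: z e.

Let Tl i j x : linear (@T i j x).
Proof.
by move=> a u v; rewrite /T grading_lin scalerDr !scalerA mulrC.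
Qed.

Lemma corona_endo_linear x : linear (@corona_endo R k n G M E l U x).
Proof. exact: (twist_endo_linear Tl). Qed.

Lemma Ck_corona_endo r : Ck_endo (E := tw) r (@corona_endo R k n G M E l U).
Proof.
apply: (Ck_twist_endo Tl) => i j; apply: Ck_endoZ; first exact: bC.
by case: Egr.
Qed.

(** The factor [z] commutes with itself, so the sign comes from the matrix alone: its nonzero blocks
    exchange two summands of opposite degree. *)
Lemma corona_endo_odd x (v : tw x) : Phi (grading v) = - grading (Phi v).
Proof.
have [_ zz _ _] := Egr.
apply/ffunP => i; rewrite corona_endoE [RHS]ffunE twist_gradingE corona_endoE.
rewrite (lin_sum (@grading_lin _ _ _ _ _ E x)) scaler_sumr -sumrN.
apply: eq_bigr => j _.
rewrite twist_gradingE !(linZ (@grading_lin _ _ _ _ _ E x)) !zz !scalerA -scaleNr.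
congr (_ *: _); rewrite /corona_mx.
by case: (split_ordP i) => i' ->; case: (split_ordP j) => j' ->;
  rewrite ?block_mxEul ?block_mxEur ?block_mxEdl ?block_mxEdr !mxE /=
    ?ltn_ord ?[(_ + _ < _)%N]ltnNge ?leq_addr /=
    ?mulrN ?mulNr ?mulr0 ?mul0r ?mulr1 ?mul1r ?opprK ?oppr0.
Qed.

Lemma corona_endo_equivariant g x (v : tw x) :
  Phi (gact g v) = gact g (Phi v) :> tw (act g x).
Proof.
have [[ga1 _] _ [_ ga6] _ _] := Eeq.
apply/ffunP => i; rewrite corona_endoE ffunE corona_endoE.
rewrite (lin_sum (ga1 g x)); apply: eq_bigr => j _.
have [[_ bG _] _ _] := bS i j.
by rewrite ffunE ga6 (linZ (ga1 g x)) bG.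
Qed.

Lemma corona_endo_selfadjoint x (v w : tw x) : herm (Phi v) w = herm v (Phi w).
Proof.
have [_ _ zh _] := Egr.
rewrite !twist_hermE.
under eq_bigr do rewrite corona_endoE herm_suml.
under [RHS]eq_bigr do rewrite corona_endoE herm_sumr.
rewrite exchange_big; apply: eq_bigr => j _; apply: eq_bigr => i _.
by rewrite hermZl hermZr zh -corona_mx_herm.
Qed.

Let S i j x (e : E x) : E x := cliff_d (fun y => b y i j) (z e).

Let Sl i j x : linear (@S i j x).
Proof. by move=> a u v; rewrite /S grading_lin cliff_d_lin. Qed.

Definition corona_anticomm x (v : tw x) : tw x := twist_endo S v.

Local Notation A := corona_anticomm.

Lemma corona_anticommE x (v : tw x) i :
  (A v : {ffun 'I_m -> E x}) i = \sum_j S i j (v j : E x).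
Proof. by rewrite ffunE. Qed.

Lemma corona_anticomm_linear x : linear (@corona_anticomm x).
Proof. exact: (twist_endo_linear Sl). Qed.

Lemma C0_corona_anticomm : Ck_endo (E := tw) 0 corona_anticomm.
Proof.
apply: (Ck_twist_endo Sl) => i j.
apply: (@Ck_endo_comp _ _ _ _ _ E 0 (@grading _ _ _ _ _ E)
  (fun x => @cliff_d _ _ _ _ _ E (fun y => b y i j) x)).
- by move=> x; exact: cliff_d_lin.
- by case: Egr.
- exact: C0_endo_cliff_d.
Qed.

Lemma twist_diracE (s : section_of tw) x i :
  (Defs.dirac s x : {ffun 'I_m -> E x}) i =
  Defs.dirac (fun y => s y i : E y) x.
Proof.
rewrite /Defs.dirac sum_ffunE; apply: eq_bigr => a _.
rewrite sum_ffunE; apply: eq_bigr => c _.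
by rewrite !ffunE.
Qed.

Lemma Ck_section_twist_comp r (s : section_of tw) i : Ck_section r s ->
  Ck_section r (fun y => s y i : E y).
Proof.
move=> sC F FE a; have := sC _ (ex_intro2 _ _ F FE erefl) (enum_rank (a, i)).
by rewrite /= enum_rankK.
Qed.

Lemma corona_anticomm_dirac (s : section_of tw) x : Ck_section 1 s ->
  Phi (Defs.dirac s x) + Defs.dirac (fun y => Phi (s y)) x = A (s x).
Proof.
move=> sC; apply/ffunP => i; rewrite ffunE corona_endoE corona_anticommE.
rewrite twist_diracE.
have sjC j : Ck_section 1 (fun y => z (s y j : E y)).
  by apply: Ck_section_grading; exact: Ck_section_twist_comp.
rewrite (_ : (fun y => _) = fun y => \sum_j b y i j *: z (s y j : E y)); last first.
  by apply: functional_extensionality_dep => y; rewrite corona_endoE.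
rewrite (@dirac_sum _ _ _ _ _ E _ _ (fun j y => b y i j *: z (s y j : E y))); last first.
  by move=> j; apply: Ck_sectionZ; [exact: bC|exact: sjC].
rewrite -big_split; apply: eq_bigr => j _ /=.
rewrite dirac_leibniz; [|exact: bC|exact: sjC].
rewrite dirac_grading; last exact: Ck_section_twist_comp.
(* The two first-order terms [b x i j *: z (D s_j)] have opposite signs, and only the zeroth-order
   term survives. *)
by rewrite twist_diracE scalerN addrCA subrr addr0.
Qed.

(** The sign in the adjoint of [cliff_d] cancels against the one from moving [z] across it, and the
    conjugate entry is the transposed one because the matrix is Hermitian. This makes the quadratic
    form in the lower bound real. *)
Lemma corona_anticomm_selfadjoint x (v w : tw x) : herm (A v) w = herm v (A w).
Proof.
have [_ _ zh _] := Egr.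
rewrite !twist_hermE.
under eq_bigr do rewrite corona_anticommE herm_suml.
under [RHS]eq_bigr do rewrite corona_anticommE herm_sumr.
rewrite exchange_big; apply: eq_bigr => j _; apply: eq_bigr => i _.
rewrite /S cliff_d_adj; last exact: bC.
rewrite zh cliff_d_grading hermNr; congr (- herm _ (z (cliff_d _ _))).
by apply/funext => y; rewrite [RHS]corona_mx_herm.
Qed.

Lemma corona_endo_sqrE x (v : tw x) i :
  (Phi (Phi v) : {ffun 'I_m -> E x}) i = \sum_j (b x *m b x) i j *: (v j : E x).
Proof.
have [_ zz _ _] := Egr.
rewrite corona_endoE; under eq_bigr do rewrite corona_endoE.
under [RHS]eq_bigr do rewrite mxE scaler_suml.
rewrite [RHS]exchange_big; apply: eq_bigr => p _.
rewrite (lin_sum (@grading_lin _ _ _ _ _ E x)) scaler_sumr; apply: eq_bigr => j _.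
by rewrite (linZ (@grading_lin _ _ _ _ _ E x)) zz scalerA.
Qed.

Lemma hnorm2_grading x (e : E x) : hnorm2 (z e) = hnorm2 e.
Proof. by have [_ zz zh _] := Egr; rewrite /hnorm2 zh zz. Qed.

Lemma hnorm2_S i j x (e : E x) :
  hnorm2 (S i j e) <= 2 * dnorm (gmetric M) (fun y => b y i j) x ^+ 2 * hnorm2 e.
Proof. by rewrite -(hnorm2_grading e); exact: hnorm2_cliff_d. Qed.

Lemma corona_anticomm_bounded : exists B : R, forall x (v : tw x),
  herm (A v) (A v) <= B%:C * herm v v.
Proof.
have /fin_all_exists[f fB] : forall p : 'I_m * 'I_m, exists B : R, forall x,
    dnorm (gmetric M) (fun y => b y p.1 p.2) x <= B.
  move=> p; have [_ _ /is_C0G_bounded[B HB]] := bS p.1 p.2.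
  exists B => x; have := HB x.
  by rewrite ger0_norm ?ler0c ?sqrtr_ge0// lecR.
pose B := \sum_p f p ^+ 2.
have dB i j x : dnorm (gmetric M) (fun y => b y i j) x ^+ 2 <= B.
  apply: (@le_trans _ _ (f (i, j) ^+ 2)).
    have fx := fB (i, j) x; rewrite ler_sqr ?nnegrE ?sqrtr_ge0//.
    by apply: le_trans fx; exact: sqrtr_ge0.
  by rewrite /B (bigD1 (i, j))//= lerDl sumr_ge0// => ? _; exact: sqr_ge0.
set q := size (index_enum 'I_m).
(* One factor [m] for the rows, [2 ^+ q] from [hnorm2_sum_le] within a row, and [2 * B] from
   [hnorm2_S] for each entry. *)
exists (m%:R * (2 ^+ q * (2 * B))) => x v.
rewrite !hermvvE -rmorphM lecR twist_hnorm2E.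
apply: (@le_trans _ _ (\sum_(i < m) 2 ^+ q * (2 * B) * hnorm2 v)); last first.
  by rewrite sumr_const card_ord -[leLHS]mulr_natl mulrA.
apply: ler_sum => i _; rewrite corona_anticommE.
apply: le_trans (hnorm2_sum_le _ _) _.
rewrite -mulrA ler_pM2l ?exprn_gt0// twist_hnorm2E mulr_sumr.
apply: ler_sum => j _; apply: le_trans (hnorm2_S i j (v j)) _.
by apply: ler_wpM2r; [exact: hnorm2_ge0|rewrite ler_pM2l].
Qed.

Lemma corona_endo_lower_bound :
  unitary_mx (map_mx (@corona_pi R k n G M) U) ->
  exists (K : set M) (c : R), [/\ cocompact K, 0 < c &
    forall x, ~ K x -> forall v : tw x,
      c%:C * herm v v <= herm (A v + Phi (Phi v)) v].
Proof.
(* Chosen so that [4 * d * m] stays below 1/2; the [+ 1] keeps [d] positive when [l] is 0. *)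
move=> Uu; pose d : R := (8 * (m%:R + 1))^-1.
have m0 : 0 <= m%:R :> R by [].
have d0 : 0 < d by rewrite invr_gt0; lra.
pose small (p : 'I_m * 'I_m) x :=
  dnorm (gmetric M) (fun y => b y p.1 p.2) x < d /\
  `|(b x *m b x) p.1 p.2 - (p.1 == p.2)%:R| < d%:C.
have [K [cK HK]] : exists K : set M, cocompact K /\
    forall x, ~ K x -> forall p, small p x.
  apply: cocompact_finite_union => p.
  have [_ _ [_ _ /(_ d d0)[A1 [cA1 HA1]]]] := bS p.1 p.2.
  have [_ _ /(_ d d0)[A2 [cA2 HA2]]] := corona_mx_sqr Uu p.1 p.2.
  exists (A1 `|` A2); split; first exact: cocompactU.
  move=> x /not_orP[/HA1 p0 /HA2 ?]; split => //.
  by move: p0; rewrite ger0_norm ?ler0c ?sqrtr_ge0// ltcR.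
exists K, 2^-1; split => // x nKx v.
have sa : herm (A v + Phi (Phi v)) v = herm v (A v + Phi (Phi v)).
  by rewrite hermDl hermDr corona_anticomm_selfadjoint !corona_endo_selfadjoint.
(* The order of [R[i]] requires equal imaginary parts, so this must vanish before real parts can be
   compared. *)
have Im0 : complex.Im (herm (A v + Phi (Phi v)) v) = 0.
  have := congr1 (@complex.Im R) sa; rewrite [in RHS]herm_conj Im_conj.
  by set t := complex.Im _ => tt; have : t + t = 0; [rewrite {1}tt addNr|lra].
rewrite hermvvE -rmorphM lecE Im0 eqxx /=.
pose e i j : R[i] := (b x *m b x) i j - (i == j)%:R.
(* The operator is the identity plus a matrix of small perturbations, estimated entry by entry. *)
have AE i : ((A v + Phi (Phi v) : tw x) : {ffun 'I_m -> E x}) i =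
    v i + \sum_j (S i j (v j : E x) + e i j *: (v j : E x)).
  rewrite ffunE corona_anticommE corona_endo_sqrE [in RHS]big_split /= addrCA.
  congr (_ + _); under [X in _ + X]eq_bigr do rewrite scalerBl.
  rewrite sumrB [X in _ + (_ - X)](_ : _ = v i); first by rewrite addrC subrK.
  rewrite (bigD1 i)//= eqxx scale1r big1 ?addr0// => j ji.
  by rewrite eq_sym (negPf ji) scale0r.
have pos i : 0 <= hnorm2 (v i : E x) by exact: hnorm2_ge0.
(* The differential [S i j] and the defect [e i j] of the square cost [d] each. *)
have bound i j : - (2 * d * (hnorm2 (v j : E x) + hnorm2 (v i : E x))) <=
    complex.Re (herm (S i j (v j : E x) + e i j *: (v j : E x)) (v i)).
  have [sd se] := HK x nKx (i, j).
  rewrite hermDl raddfD /=.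
  have h1 : - (d * (hnorm2 (v j : E x) + hnorm2 (v i : E x))) <=
      complex.Re (herm (S i j (v j : E x)) (v i)).
    apply: Re_herm_ge => //; apply: le_trans (hnorm2_S i j _) _.
    apply: ler_wpM2r => //; rewrite ler_pM2l// ler_sqr ?nnegrE ?sqrtr_ge0//.
      exact: ltW sd.
    exact: ltW d0.
  have h2 : - (d * (hnorm2 (v j : E x) + hnorm2 (v i : E x))) <=
      complex.Re (herm (e i j *: (v j : E x)) (v i)).
    apply: Re_herm_ge => //; rewrite hnorm2Z; apply: ler_wpM2r => //.
    have r0 : 0 <= complex.Re `|e i j| by rewrite -ler0c -normcR.
    move: se; rewrite -/(e i j) normcR ltcR; set r := complex.Re _ in r0 * => rd.
    rewrite (_ : complex.Re _ = r * r) ?expr2 /= ?mulr0 ?subr0//.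
    have : r * r <= d * d by apply: ler_pM => //; exact: ltW.
    have : 0 <= d * d by rewrite mulr_ge0// ltW.
    lra.
  lra.
set N := hnorm2 v.
have NE : N = \sum_i hnorm2 (v i : E x) by exact: twist_hnorm2E.
have N0 : 0 <= N by exact: hnorm2_ge0.
(* Over all pairs, each component is counted [m] times in either position. *)
have sumE : \sum_(i < m) \sum_(j < m) (hnorm2 (v j : E x) + hnorm2 (v i : E x)) =
    2 * (m%:R * N).
  under eq_bigr do rewrite big_split sumr_const card_ord -NE /=.
  rewrite big_split sumr_const card_ord sumrMnl -NE /=.
  by rewrite -mulr2n !mulr_natl.
have : N - 2 * d * (2 * (m%:R * N)) <=
    complex.Re (herm (A v + Phi (Phi v) : tw x) v).
  rewrite -sumE {1}NE twist_hermE raddf_sum mulr_sumr -sumrB.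
  apply: ler_sum => i _; rewrite AE hermDl raddfD lerD// herm_suml raddf_sum.
  by rewrite mulr_sumr -sumrN; apply: ler_sum => j _; exact: bound.
apply: le_trans.
have : d * (8 * (m%:R + 1)) = 1 by rewrite mulVf// gt_eqF//; lra.
move=> dm; have dN : d * (8 * (m%:R + 1)) * N = N by rewrite dm mul1r.
have : 0 <= d * N by rewrite mulr_ge0// ltW.
lra.
Qed.

End CoronaEndomorphism.

Theorem proposition6p5 (R : realType) (k n : nat) (G : lieGroupType R k)
    (M : gRiemannian n G) (n_even : ~~ odd n)
    (M_complete : riem_complete (gmetric M)) (M_ncc : non_cocompact M)
    (E0 : gCliffordBundle M) (l : nat)
    (U0 : 'M[CbG_mod_C0G M]_l)
    (U0_corona : forall i j, higson_corona (U0 i j))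
    (U0_unitary : unitary_mx U0)
    (U : 'M[CbG M]_l)
    (U_smooth : forall i j, is_CginfG (U i j))
    (U_lift : map_mx (@corona_pi R k n G M) U = U0) :
  is_admissible (@corona_endo R k n G M E0 l U).
Proof.
split.
- split; first exact: corona_endo_linear.
  exact: Ck_corona_endo.
- exact: corona_endo_odd.
- exact: corona_endo_equivariant.
- exact: corona_endo_selfadjoint.
exists (@corona_anticomm R k n G M E0 l U); split.
- split; last exact: C0_corona_anticomm.
  exact: corona_anticomm_linear.
- by move=> s sC x; exact: corona_anticomm_dirac.
- exact: corona_anticomm_bounded.
- by apply: corona_endo_lower_bound; rewrite ?U_lift.
Qed.
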